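(* In a PRAM computer with a large enough number of processors ($P\to\infty$), and for the finite-state control problem with $D_x$ states, $D_u$ controls and $T$ time steps, the span time complexity of the parallel algorithms described in the context is as follows: (i) computing the value functions and the control law takes $O(\log D_u+(\log T)(\log D_x))$; (ii) recovering the optimal trajectory takes $O(\log T)$ with Method 1, and $O(\log D_u+\log D_x+(\log T)(\log D_x))$ with Method 2.
   Context: Problem: states $x_k\in\{1,\dots,D_x\}$, controls $u_k\in\{1,\dots,D_u\}$, dynamics $x_{k+1}=f_k(x_k,u_k)$, bounded-below stage costs $\ell_k(x_k,u_k)$ and terminal cost $\ell_T(x_T)$, stored as tables. Value functions: $V_T=\ell_T$, $V_k(x_k)=\min_{u_k}\{\ell_k(x_k,u_k)+V_{k+1}(f_k(x_k,u_k))\}$; control law $u_k(x_k)=\arg\min_{u_k}\{\ell_k(x_k,u_k)+V_{k+1}(f_k(x_k,u_k))\}$; optimal trajectory $x_S^*=x_S$, $x_{k+1}^*=f_k^*(x_k^* )$ with $f_k^*(x)=f_k(x,u_k(x))$. Conditional value functions: $V_{k\to i}(x_k,x_i)$ is the minimal cost $\sum_{n=k}^{i-1}\ell_n(x_n,u_n)$ over controls steering $x_k$ to $x_i$ under the dynamics ($\infty$ if impossible). Machine model: a PRAM (parallel random access machine) has identical processors with a common clock and shared random access memory; the number of processors is taken large enough not to limit the parallelisation. Span time is the number of parallel steps. Minimisation over a finite set of $n$ alternatives is carried out by parallel reduction in $O(\log n)$ span. The parallel scan algorithm (up-sweep and down-sweep over a binary tree) computes all prefix (or suffix) products of $T$ elements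 under an associative operator using $O(\log T)$ successive rounds, the operator applications in each round being done in parallel. Logarithms inside $O(\cdot)$ are understood as $\max(1,\log)$. Algorithms: - Value functions and control law: initialise in parallel $a_k=V_{k\to k+1}$ for $k<T$ (a $D_x\times D_x$ table, obtained by minimising over the control) and $a_T=V_T$; run a backward parallel scan with $(a\otimes b)(x,y)=\min_z\{V_a(x,z)+V_b(z,y)\}$, which yields $a_k\otimes\cdots\otimes a_T=V_k$; then compute $u_k(x_k)$ for all $k$ and $x_k$ in parallel from the formula above. - Trajectory recovery, Method 1 (given the control law): initialise $a_S$ as the constant function with value $f_S^*(x_S)$ and $a_k=f_k^*$ for $k>S$ (vectors of length $D_x$), and run a forward parallel scan with the operator $a\otimes b=f_b\circ f_a$; then $a_S\otimes\cdots\otimes a_{k-1}=x_k^*$. - Trajectory recovery, Method 2: compute $V_{S\to k}(x_S,\cdot)$ for all $k$ by initialising $a_k=V_{k\to k+1}$ and running a forward parallel scan with $(a\otimes b)(x,y)=\min_z\{V_a(x,z)+V_b(z,y)\}$, and then, with the value functions $V_k$ available, compute in parallel for all $k$ $x_k^*=\arg\min_{x_k}\{V_{S\to k}(x_S,x_k)+V_k(x_k)\}$. *)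

(* Defs.v *)
From HB Require Import structures.
From mathcomp Require Export all_boot all_order all_algebra.
From mathcomp Require Export reals constructive_ereal exp.

Set Implicit Arguments.
Unset Strict Implicit.
Unset Printing Implicit Defensive.

Import Order.TTheory GRing.Theory Num.Theory.

Local Open Scope ring_scope.

(** * The finite-state control problem *)

(** States are ['I_Dx], controls are ['I_Du].  The horizon [T] is a separate
    argument below; the values of [dyn k] and [stage k] for [k >= T] are never
    used.  Real-valued costs on finite sets are automatically bounded below. *)
Record control_problem (R : realType) (Dx Du : nat) := ControlProblem {
  dyn : nat -> 'I_Dx -> 'I_Du -> 'I_Dx;
  stage : nat -> 'I_Dx -> 'I_Du -> R;
  terminal : 'I_Dx -> R }.

Definition minimises (R : realType) (A : Type) (Q : A -> \bar R) (x : A) : Prop :=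
  forall y : A, (Q x <= Q y)%E.

(** [value_to_go cp n k] is the value function at time [k] with [n] steps left.
    As there are finitely many controls, the minimum is an iterated binary
    minimum in the extended reals, where [+oo] is neutral. *)
Fixpoint value_to_go (R : realType) (Dx Du : nat)
    (cp : control_problem R Dx Du) (n k : nat) (x : 'I_Dx) : \bar R :=
  if n is n'.+1 then
    \big[Order.min/+oo%E]_(u < Du)
      ((stage cp k x u)%:E + value_to_go cp n' k.+1 (dyn cp k x u))%E
  else (terminal cp x)%:E.

Definition value (R : realType) (Dx Du : nat) (cp : control_problem R Dx Du)
    (T k : nat) (x : 'I_Dx) : \bar R :=
  value_to_go cp (T - k) k x.

Definition q_value (R : realType) (Dx Du : nat) (cp : control_problem R Dx Du)
    (T k : nat) (x : 'I_Dx) (u : 'I_Du) : \bar R :=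
  ((stage cp k x u)%:E + value cp T k.+1 (dyn cp k x u))%E.

(** The argmin need not be unique: a control law is any selection from it. *)
Definition control_law (R : realType) (Dx Du : nat)
    (cp : control_problem R Dx Du) (T : nat) (mu : nat -> 'I_Dx -> 'I_Du) : Prop :=
  forall k x, (k < T)%N -> minimises (q_value cp T k x) (mu k x).

(** [optimal_state cp mu S xS n] is the state at time [S + n]. *)
Fixpoint optimal_state (R : realType) (Dx Du : nat)
    (cp : control_problem R Dx Du) (mu : nat -> 'I_Dx -> 'I_Du)
    (S : nat) (xS : 'I_Dx) (n : nat) : 'I_Dx :=
  if n is n'.+1 then
    let x := optimal_state cp mu S xS n' in dyn cp (S + n') x (mu (S + n') x)
  else xS.

Fixpoint steer (R : realType) (Dx Du : nat) (cp : control_problem R Dx Du)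
    (k : nat) (x : 'I_Dx) (us : seq 'I_Du) : 'I_Dx :=
  if us is u :: us' then steer cp k.+1 (dyn cp k x u) us' else x.

Fixpoint steer_cost (R : realType) (Dx Du : nat) (cp : control_problem R Dx Du)
    (k : nat) (x : 'I_Dx) (us : seq 'I_Du) : R :=
  if us is u :: us' then stage cp k x u + steer_cost cp k.+1 (dyn cp k x u) us'
  else 0.

Definition cond_value (R : realType) (Dx Du : nat) (cp : control_problem R Dx Du)
    (k i : nat) (x y : 'I_Dx) : \bar R :=
  \big[Order.min/+oo%E]_(us : (i - k).-tuple 'I_Du | steer cp k x us == y)
    (steer_cost cp k x us)%:E.

(** * The PRAM *)

(** The shared memory is organised in multi-dimensional arrays: the address
    [t :: [:: i1; ...; im]] is the cell of index [(i1, ..., im)] of array [t].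
    A cell holds an index (a state or a control) or an extended real cost. *)
Inductive word (R : realType) : Type :=
  | Idx of nat
  | Cost of \bar R.
Arguments Idx {R} _.

Definition index_of (R : realType) (w : word R) : nat :=
  if w is Idx n then n else 0%N.

Definition cost_of (R : realType) (w : word R) : \bar R :=
  if w is Cost c then c else 0%E.

Definition addr := seq nat.

Definition memory (R : realType) := addr -> word R.

(** The unit-time instructions; the first address is the one written.
    [Fetch a p b q] is indirect: it reads the cell of address [p ++ n :: q]
    where [n] is the index held in [b]. *)
Inductive instr : Type :=
  | Const of addr & nat
  | Infty of addr
  | Move of addr & addr
  | Fetch of addr & addr & addr & addr
  | Add of addr & addr & addr
  | IfLe of addr & addr & addr & addr & addr
  | IfEq of addr & addr & nat & addr & addr.

Definition target (i : instr) : addr :=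
  match i with
  | Const a _ | Infty a | Move a _ | Fetch a _ _ _ | Add a _ _
  | IfLe a _ _ _ _ | IfEq a _ _ _ _ => a
  end.

Definition result (R : realType) (M : memory R) (i : instr) : word R :=
  match i with
  | Const _ n => Idx n
  | Infty _ => Cost +oo%E
  | Move _ b => M b
  | Fetch _ p b q => M (p ++ index_of (M b) :: q)
  | Add _ b c => Cost (cost_of (M b) + cost_of (M c))%E
  | IfLe _ b c d e => if (cost_of (M b) <= cost_of (M c))%E then M d else M e
  | IfEq _ b n d e => if index_of (M b) == n then M d else M e
  end.

(** One parallel step lists the instructions executed simultaneously, one per
    active processor.  The cells named by an instruction are literals and a
    program may depend on the problem sizes only; data-dependent addressing is
    [Fetch].  All reads precede all writes; concurrent reads are
    allowed and concurrent writes to one cell are not. *)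
Definition pstep := seq instr.

Definition program := seq pstep.

Definition step_ok (P : nat) (s : pstep) : bool :=
  (size s <= P)%N && uniq (map target s).

Definition run_step (R : realType) (M : memory R) (s : pstep) : memory R :=
  fun a => foldr (fun i w => if target i == a then result M i else w) (M a) s.

(** [pram_run P p M M' t]: on [P] processors, program [p] takes the memory
    from [M] to [M'] in [t] parallel steps. *)
Inductive pram_run (R : realType) (P : nat) :
    program -> memory R -> memory R -> nat -> Prop :=
  | run_nil M : pram_run P [::] M M 0
  | run_cons s p M M' t :
      step_ok P s -> pram_run P p (run_step M s) M' t ->
      pram_run P (s :: p) M M' t.+1.

Notation "[ 'par' i <- s => e ]" := (flatten [seq e | i <- s])
  (at level 0, i name, s at level 99,
   format "[ 'par'  i  <-  s  => '/  '  e ]").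

(** * Memory layout *)

(** The first component of an address is the tag of its array; the prefixes of
    the indirect reads below consist of a tag and leading indices, as in
    [cG k x = [:: 8; k] ++ [:: x]]. *)

Definition cF (k x u : nat) : addr := [:: 0; k; x; u].   (* dynamics *)
Definition cL (k x u : nat) : addr := [:: 1; k; x; u].   (* stage costs *)
Definition cLT (x : nat) : addr := [:: 2; x].            (* terminal cost *)
Definition cV (k x : nat) : addr := [:: 3; k; x].        (* value functions *)
Definition cU (k x : nat) : addr := [:: 4; k; x].        (* control law *)
Definition cX (k : nat) : addr := [:: 5; k].             (* trajectory *)
Definition cX0 : addr := [:: 6].                         (* initial state *)
Definition cA (k x y : nat) : addr := [:: 7; k; x; y].   (* scan, tables *)
Definition cG (k x : nat) : addr := [:: 8; k; x].        (* scan, vectors *)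
Definition cInf : addr := [:: 9].
Definition cW (p : seq nat) (j : nat) : addr := 10 :: rcons p j.
Definition cI (p : seq nat) (j : nat) : addr := 11 :: rcons p j.

(** * Parallel reduction *)

(** For all [p] in [ps] in parallel, [min_reduce ps n] replaces [cW p 0] by the
    minimum of [cW p j] over [j < n]; [argmin_reduce] moreover replaces
    [cI p 0] by the entry [cI p j] of a minimiser [j].  Round [h] combines the
    entries [j] and [j + 2 ^ h] for the multiples [j] of [2 ^ h.+1]. *)
Definition reduce_index (n h : nat) : seq nat :=
  [seq j <- iota 0 n | (2 ^ h.+1 %| j)%N && (j + 2 ^ h < n)%N].

Definition min_round (ps : seq (seq nat)) (n h : nat) : pstep :=
  [par p <- ps => [par j <- reduce_index n h =>
    [:: IfLe (cW p j) (cW p j) (cW p (j + 2 ^ h)%N)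
             (cW p j) (cW p (j + 2 ^ h)%N)]]].

Definition min_reduce (ps : seq (seq nat)) (n : nat) : program :=
  [seq min_round ps n h | h <- iota 0 (up_log 2 n)].

Definition index_round (ps : seq (seq nat)) (n h : nat) : pstep :=
  [par p <- ps => [par j <- reduce_index n h =>
    [:: IfLe (cI p j) (cW p j) (cW p (j + 2 ^ h)%N)
             (cI p j) (cI p (j + 2 ^ h)%N)]]].

Definition argmin_reduce (ps : seq (seq nat)) (n : nat) : program :=
  [par h <- iota 0 (up_log 2 n) =>
    [:: index_round ps n h; min_round ps n h]].

(** * Parallel scan *)

(** Each round is a list of pairs [(i, j)] with [i < j], standing for the
    simultaneous in-place updates [a_j := a_i (x) a_j].  After the up-sweep and
    the down-sweep, [a_j] holds the product of the initial [a_0, ..., a_j]. *)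
Definition up_round (n d : nat) : seq (nat * nat) :=
  [seq ((j - 2 ^ d)%N, j) | j <- iota 0 n & (2 ^ d.+1 %| j.+1)%N].

Definition down_round (n d : nat) : seq (nat * nat) :=
  [seq (j, (j + 2 ^ d)%N) |
    j <- iota 0 n & (2 ^ d.+1 %| j.+1)%N && (j + 2 ^ d < n)%N].

Definition scan_rounds (n : nat) : seq (seq (nat * nat)) :=
  [seq up_round n d | d <- iota 0 (up_log 2 n)] ++
  [seq down_round n d | d <- rev (iota 0 (up_log 2 n))].

(** [minplus_round Dx ts] performs, for all [(d, (a, b))] in [ts] in parallel,
    the update [A_d := A_a (x) A_b] of tables under the min-plus product. *)
Definition minplus_round (Dx : nat) (ts : seq (nat * (nat * nat))) : program :=
  [:: [par t <- ts => [par x <- iota 0 Dx => [par y <- iota 0 Dx =>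
        [par z <- iota 0 Dx =>
          [:: Add (cW [:: t.1; x; y] z) (cA t.2.1 x z) (cA t.2.2 z y)]]]]]] ++
  min_reduce [par t <- ts => [par x <- iota 0 Dx => [par y <- iota 0 Dx =>
               [:: [:: t.1; x; y]]]]] Dx ++
  [:: [par t <- ts => [par x <- iota 0 Dx => [par y <- iota 0 Dx =>
        [:: Move (cA t.1 x y) (cW [:: t.1; x; y] 0)]]]]].

(** Forward scan of the tables at times [S, ..., S + n - 1]. *)
Definition forward_minplus_scan (Dx S n : nat) : program :=
  [par rs <- scan_rounds n =>
    minplus_round Dx
      [seq ((S + r.2)%N, ((S + r.1)%N, (S + r.2)%N)) | r <- rs]].

(** Backward scan of the tables at times [0, ..., T]: position [i] of the scan
    is time [T - i], and the operands are swapped. *)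
Definition backward_minplus_scan (Dx T : nat) : program :=
  [par rs <- scan_rounds T.+1 =>
    minplus_round Dx
      [seq ((T - r.2)%N, ((T - r.2)%N, (T - r.1)%N)) | r <- rs]].

(** Forward scan of the vectors at times [S, ..., S + n - 1] under composition. *)
Definition forward_composition_scan (Dx S n : nat) : program :=
  [seq [par r <- rs => [par x <- iota 0 Dx =>
     [:: Fetch (cG (S + r.2)%N x) [:: 8; (S + r.2)%N] (cG (S + r.1)%N x) [::]]]]
  | rs <- scan_rounds n].

(** * The algorithms *)

(** Stores the one-step conditional value functions of the times in [ks]. *)
Definition one_step_program (Dx Du : nat) (ks : seq nat) : program :=
  [:: [:: Infty cInf];
      [par k <- ks => [par x <- iota 0 Dx => [par y <- iota 0 Dx =>
        [par u <- iota 0 Du =>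
          [:: IfEq (cW [:: k; x; y] u) (cF k x u) y (cL k x u) cInf]]]]]] ++
  min_reduce [par k <- ks => [par x <- iota 0 Dx => [par y <- iota 0 Dx =>
               [:: [:: k; x; y]]]]] Du ++
  [:: [par k <- ks => [par x <- iota 0 Dx => [par y <- iota 0 Dx =>
        [:: Move (cA k x y) (cW [:: k; x; y] 0)]]]]].

(** The last element of the scan is stored as a table constant in its second
    argument; hence so are all the suffix products. *)
Definition value_program (Dx Du T : nat) : program :=
  one_step_program Dx Du (iota 0 T) ++
  [:: [par x <- iota 0 Dx => [par y <- iota 0 Dx =>
        [:: Move (cA T x y) (cLT x)]]]] ++
  backward_minplus_scan Dx T ++
  [:: [par k <- iota 0 T.+1 => [par x <- iota 0 Dx =>
        [:: Move (cV k x) (cA k x 0)]]]].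

Definition law_program (Dx Du T : nat) : program :=
  [:: [par k <- iota 0 T => [par x <- iota 0 Dx => [par u <- iota 0 Du =>
        [:: Fetch (cW [:: k; x] u) [:: 3; k.+1] (cF k x u) [::]]]]];
      [par k <- iota 0 T => [par x <- iota 0 Dx => [par u <- iota 0 Du =>
        [:: Add (cW [:: k; x] u) (cL k x u) (cW [:: k; x] u)]]]];
      [par k <- iota 0 T => [par x <- iota 0 Dx => [par u <- iota 0 Du =>
        [:: Const (cI [:: k; x] u) u]]]]] ++
  argmin_reduce [par k <- iota 0 T => [par x <- iota 0 Dx => [:: [:: k; x]]]] Du ++
  [:: [par k <- iota 0 T => [par x <- iota 0 Dx =>
        [:: Move (cU k x) (cI [:: k; x] 0)]]]].

Definition value_and_law_program (Dx Du T : nat) : program :=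
  value_program Dx Du T ++ law_program Dx Du T.

(** The second step makes the first element of the scan constant; it reads the
    old contents of the vector that it overwrites. *)
Definition trajectory_program1 (Dx T S : nat) : program :=
  [:: [par k <- iota S (T - S) => [par x <- iota 0 Dx =>
        [:: Fetch (cG k x) [:: 0; k; x] (cU k x) [::]]]];
      [par x <- iota 0 Dx =>
        [:: Fetch (cG S x) [:: 8; S] cX0 [::]]]] ++
  forward_composition_scan Dx S (T - S) ++
  [:: Move (cX S) cX0 ::
      [par k <- iota S (T - S) => [:: Move (cX k.+1) (cG k 0)]]].

(** After the scan, the table at time [k] is the conditional value function
    from [S] to [k.+1], of which only the row of the initial state is used. *)
Definition trajectory_program2 (Dx Du T S : nat) : program :=
  one_step_program Dx Du (iota S (T - S)) ++
  forward_minplus_scan Dx S (T - S) ++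
  [:: [par k <- iota S (T - S) => [par x <- iota 0 Dx =>
        [:: Fetch (cW [:: k.+1] x) [:: 7; k] cX0 [:: x]]]];
      [par k <- iota S (T - S) => [par x <- iota 0 Dx =>
        [:: Add (cW [:: k.+1] x) (cW [:: k.+1] x) (cV k.+1 x)]]];
      [par k <- iota S (T - S) => [par x <- iota 0 Dx =>
        [:: Const (cI [:: k.+1] x) x]]]] ++
  argmin_reduce [par k <- iota S (T - S) => [:: [:: k.+1]]] Dx ++
  [:: Move (cX S) cX0 ::
      [par k <- iota S (T - S) => [:: Move (cX k.+1) (cI [:: k.+1] 0)]]].

(** * Contents of the memory *)

(** Cells that are not mentioned have arbitrary contents. *)
Definition stores_problem (R : realType) (Dx Du : nat)
    (cp : control_problem R Dx Du) (T : nat) (M : memory R) : Prop :=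
  (forall (k : nat) (x : 'I_Dx) (u : 'I_Du), (k < T)%N ->
     M (cF k x u) = Idx (dyn cp k x u) /\
     M (cL k x u) = Cost (stage cp k x u)%:E) /\
  (forall x : 'I_Dx, M (cLT x) = Cost (terminal cp x)%:E).

Definition stores_values (R : realType) (Dx Du : nat)
    (cp : control_problem R Dx Du) (T : nat) (M : memory R) : Prop :=
  forall (k : nat) (x : 'I_Dx), (k <= T)%N ->
    M (cV k x) = Cost (value cp T k x).

Definition stores_law (R : realType) (Dx Du : nat) (T : nat)
    (mu : nat -> 'I_Dx -> 'I_Du) (M : memory R) : Prop :=
  forall (k : nat) (x : 'I_Dx), (k < T)%N -> M (cU k x) = Idx (mu k x).

Definition stores_trajectory (R : realType) (Dx : nat) (T S : nat)
    (xs : nat -> 'I_Dx) (M : memory R) : Prop :=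
  forall k : nat, (S <= k <= T)%N -> M (cX k) = Idx (xs k).

Definition lg (R : realType) (n : nat) : R := Num.max 1 (ln n%:R).

(* Main.v *)
From HB Require Import structures.
Require Import Defs.
From mathcomp Require Import sequences zify ring lra.

(** The programs are straight-line, so a run takes as many steps as the program
    has, and the work is to show that they compute what they should.  The scan
    is handled for an abstract family of products: the cell [j] always holds the
    product over an interval of positions ending in [j], whose length after the
    up-sweep is the largest power of 2 dividing [j.+1]; the down-sweep then
    prepends the missing initial interval.  For the tables, these interval
    products are conditional value functions, since the Bellman recursion over
    [m + n] steps is the min-plus product of those over [m] and over [n] steps. *)

Set Implicit Arguments.
Unset Strict Implicit.
Unset Printing Implicit Defensive.

Import Order.TTheory GRing.Theory Num.Theory.
Local Open Scope ring_scope.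

(** * Execution of programs *)

(** Exclusive writes are more than a rule of the machine here. The semantics of a step scans its
    list of instructions, so it is only when no cell is written twice that each written cell has a
    value independent of the order of that list. Most of the work on nested loops consists in
    recovering the loop indices from the address written. The algebraic obstacle is infinity.
    Unreachable states cost [+oo], and since [+oo + -oo = -oo], moving a sum inside an iterated
    minimum requires a summand above [-oo]; this bound therefore accompanies the Bellman recursions.
    It holds because stage costs are real and the final costs are real, [0] or [+oo]. The scan is
    stated without an operator: associativity appears only as the gluing of adjacent intervals,
    which for the tables is the splitting of a conditional value function at an intermediate time.
    The lengths of the programs involve [up_log 2], the rounded-up binary logarithm, whereas [lg] is
    natural; the crude bound [1/2 <= ln 2] and [1 <= lg] turn all additive terms into the constants
    40 and 9. *)

Definition instr_code (i : instr) : nat * nat * seq addr :=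
  match i with
  | Const a n => (0, n, [:: a])
  | Infty a => (1, 0, [:: a])
  | Move a b => (2, 0, [:: a; b])
  | Fetch a p b q => (3, 0, [:: a; p; b; q])
  | Add a b c => (4, 0, [:: a; b; c])
  | IfLe a b c d e => (5, 0, [:: a; b; c; d; e])
  | IfEq a b n d e => (6, n, [:: a; b; d; e])
  end%N.

Definition instr_decode (c : nat * nat * seq addr) : option instr :=
  match c with
  | (0, n, [:: a]) => Some (Const a n)
  | (1, _, [:: a]) => Some (Infty a)
  | (2, _, [:: a; b]) => Some (Move a b)
  | (3, _, [:: a; p; b; q]) => Some (Fetch a p b q)
  | (4, _, [:: a; b; c]) => Some (Add a b c)
  | (5, _, [:: a; b; c; d; e]) => Some (IfLe a b c d e)
  | (6, n, [:: a; b; d; e]) => Some (IfEq a b n d e)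
  | _ => None
  end%N.

Lemma instr_codeK : pcancel instr_code instr_decode.
Proof. by case. Qed.

(** Equality on instructions is wanted so that [i \in s] makes sense for a parallel step [s]. *)
HB.instance Definition _ := Equality.copy instr (pcan_type instr_codeK).

(** The half of [step_ok] that does not depend on the number of processors; the other half is
    settled once, by taking as many processors as the largest step has instructions. *)
Definition exclusive (s : pstep) : bool := uniq (map target s).

(** Arrays are told apart by the head of the address, so a short list of tags is enough to frame a
    whole program, without listing the cells it writes. *)
Definition writes (tags : seq nat) (s : pstep) : bool :=
  all (fun i => head 0%N (target i) \in tags) s.

Definition exec (R : realType) (M : memory R) (p : program) : memory R :=
  foldl (@run_step R) M p.

Arguments exec : simpl never.

Lemma exec_cons (R : realType) (M : memory R) s p :
  exec M (s :: p) = exec (run_step M s) p.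
Proof. by []. Qed.

Lemma exec_cat (R : realType) (M : memory R) p q :
  exec M (p ++ q) = exec (exec M p) q.
Proof. exact: foldl_cat. Qed.

Lemma run_step_frame (R : realType) (M : memory R) s a :
  a \notin map target s -> run_step M s a = M a.
Proof.
rewrite /run_step; elim: s => //= i s IH; rewrite inE negb_or eq_sym.
by case/andP => /negPf -> /IH.
Qed.

(** On a conflict [run_step] would keep the earliest instruction of the list; exclusivity ensures
    that no other instruction has the target of [i]. *)
Lemma run_step_target (R : realType) (M : memory R) s i :
  exclusive s -> i \in s -> run_step M s (target i) = result M i.
Proof.
rewrite /exclusive /run_step; elim: s => //= j s IH /andP[js us]; rewrite inE.
case/predU1P => [->|si]; first by rewrite eqxx.
by rewrite (negPf (contraNneq _ js)) ?IH // => ->; exact: map_f.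
Qed.

Lemma run_step_at (R : realType) (M : memory R) s i a :
  exclusive s -> i \in s -> target i = a -> run_step M s a = result M i.
Proof. by move=> es si <-; exact: run_step_target. Qed.

Lemma writes_notin tags s a :
  writes tags s -> head 0%N a \notin tags -> a \notin map target s.
Proof. by move=> /allP ws; apply: contra => /mapP[i /ws + ->]. Qed.

Lemma exec_frame (R : realType) (M : memory R) tags p a :
  all (writes tags) p -> head 0%N a \notin tags -> exec M p a = M a.
Proof.
elim: p M => //= s p IH M /andP[ws wp] ha.
by rewrite exec_cons IH // run_step_frame // (writes_notin ws).
Qed.

Lemma pram_run_exec (R : realType) P (M : memory R) p :
  (\max_(s <- p) size s <= P)%N -> all exclusive p ->
  pram_run P p M (exec M p) (size p).
Proof.
elim: p M => [|s p IH] M /=; first by move=> _ _; constructor.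
rewrite big_cons geq_max => /andP[sP pP] /andP[es ep]; constructor.
  by rewrite /step_ok sP.
exact: IH.
Qed.

(** * Exclusive writes in nested parallel loops *)

Lemma all_par (I : Type) (T : Type) (a : pred T) (s : seq I) (e : I -> seq T) :
  all a [par i <- s => e i] = all (fun i => all a (e i)) s.
Proof. by elim: s => //= i s IH; rewrite all_cat IH. Qed.

(** The key [f] is there because the loop variable may be a record of which the address shows one
    field only: a scan update is recognised by its destination. *)
Lemma uniq_par (I J T : eqType) (f : I -> J) (s : seq I) (e : I -> seq T) :
  uniq (map f s) -> (forall i, i \in s -> uniq (e i)) ->
  (forall i j a, a \in e i -> a \in e j -> f i = f j) ->
  uniq [par i <- s => e i].
Proof.
move=> + + inj; elim: s => //= i s IH /andP[is_ us] ue.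
rewrite cat_uniq ue ?mem_head //= IH // => [|j js]; last first.
  by rewrite ue // inE js orbT.
rewrite andbT; apply/hasPn => a /flatten_mapP[j js aj].
apply: contra is_ => /inj/(_ aj) ->; exact: map_f.
Qed.

Lemma exclusive_par_key (I J : eqType) (f : I -> J) (s : seq I) (e : I -> pstep) :
  uniq (map f s) -> (forall i, i \in s -> exclusive (e i)) ->
  (forall i j a, a \in map target (e i) -> a \in map target (e j) -> f i = f j) ->
  exclusive [par i <- s => e i].
Proof.
by move=> us ue inj; rewrite /exclusive map_flatten -map_comp; exact: uniq_par us _ _.
Qed.

Lemma exclusive_par (I : eqType) (s : seq I) (e : I -> pstep) :
  uniq s -> (forall i, i \in s -> exclusive (e i)) ->
  (forall i j a, a \in map target (e i) -> a \in map target (e j) -> i = j) ->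
  exclusive [par i <- s => e i].
Proof. by move=> us; apply: (exclusive_par_key (f := id)); rewrite map_id. Qed.

Lemma mem_target_par (I : eqType) (s : seq I) (e : I -> pstep) a :
  a \in map target [par i <- s => e i] ->
  exists2 i, i \in s & a \in map target (e i).
Proof. by rewrite map_flatten -map_comp => /flatten_mapP. Qed.

Ltac target_of_par :=
  repeat (case/mem_target_par => ? _); rewrite /= inE => /eqP.

Ltac writes_pars :=
  rewrite /writes ?all_par;
  repeat first [done | apply/allP => ? _; rewrite ?all_par].

(** * Parallel reduction *)

Definition combines (n h j : nat) : bool :=
  (2 ^ h.+1 %| j)%N && (j + 2 ^ h < n)%N.

(* The index of the entry that cell [j] holds after [h] rounds. *)
Fixpoint champion (R : realType) (n : nat) (w : nat -> \bar R) (h j : nat) : nat :=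
  if h is h'.+1 then
    let i := champion n w h' j in
    let i' := champion n w h' (j + 2 ^ h')%N in
    if combines n h' j && ~~ (w i <= w i')%E then i' else i
  else j.

Lemma mem_reduce_index n h j : (j \in reduce_index n h) = combines n h j.
Proof.
rewrite mem_filter mem_iota leq0n add0n; apply: andb_idr => /andP[_].
by apply: leq_ltn_trans; exact: leq_addr.
Qed.

(** After [h] rounds a multiple [j] of [2 ^ h] answers for the block of length [2 ^ h] that starts
    at [j], cut off at [n]. A round joins two neighbouring blocks; if the right one starts at [n] or
    later, it is empty and skipping it loses nothing. *)
Lemma champion_min (R : realType) n (w : nat -> \bar R) h j :
  (2 ^ h %| j)%N -> (j < n)%N ->
  (champion n w h j < n)%N /\
  forall i, (j <= i < j + 2 ^ h)%N -> (i < n)%N -> (w (champion n w h j) <= w i)%E.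
Proof.
elim: h j => [|h IH] j dj jn /=.
  by split=> // i; rewrite expn0 addn1 ltnS -eqn_leq => /eqP <-.
have dj' : (2 ^ h %| j)%N by apply: dvdn_trans dj; rewrite expnS dvdn_mull.
have [lt1 le1] := IH j dj' jn.
rewrite /combines dj /=; case: (ltnP (j + 2 ^ h)%N n) => /= jn'; last first.
  by split=> // i /andP[ji _] i_n; apply: le1 => //; lia.
have [lt2 le2] := IH (j + 2 ^ h)%N (dvdn_add dj' (dvdnn _)) jn'.
case: leP => /= cmp; split=> // i /andP[ji ij] i_n.
  case: (ltnP i (j + 2 ^ h)) => ih; first by apply: le1; rewrite ?ji.
  by apply: (le_trans cmp); apply: le2 => //; rewrite expnS in ij; lia.
case: (ltnP i (j + 2 ^ h)) => ih; last first.
  by apply: le2 => //; rewrite expnS in ij; lia.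
by apply: (le_trans (ltW cmp)); apply: le1; rewrite ?ji.
Qed.

Lemma champion_argmin (R : realType) n (w : nat -> \bar R) :
  let i := champion n w (up_log 2 n) 0 in (0 < n)%N ->
  (i < n)%N /\ forall j, (j < n)%N -> (w i <= w j)%E.
Proof.
move=> i n0; have [|i_n le_i] := @champion_min R n w (up_log 2 n) 0 _ n0.
  exact: dvdn0.
by split=> // j jn; apply: le_i => //=; apply: leq_trans jn _; exact: up_logP.
Qed.

Lemma cW_inj p p' j j' : cW p j = cW p' j' -> p = p' /\ j = j'.
Proof. by case=> /rcons_inj[]. Qed.

Lemma cI_inj p p' j j' : cI p j = cI p' j' -> p = p' /\ j = j'.
Proof. by case=> /rcons_inj[]. Qed.

Lemma reduce_index_uniq n h : uniq (reduce_index n h).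
Proof. by rewrite filter_uniq // iota_uniq. Qed.

Lemma min_round_exclusive ps n h : uniq ps -> exclusive (min_round ps n h).
Proof.
move=> ups; apply: exclusive_par => // [p _|p p' a].
  apply: exclusive_par => //; first exact: reduce_index_uniq.
  by move=> j j' a; rewrite /= !inE => /eqP -> /eqP /cW_inj[].
by target_of_par => ->; target_of_par => /cW_inj[].
Qed.

Lemma index_round_exclusive ps n h : uniq ps -> exclusive (index_round ps n h).
Proof.
move=> ups; apply: exclusive_par => // [p _|p p' a].
  apply: exclusive_par => //; first exact: reduce_index_uniq.
  by move=> j j' a; rewrite /= !inE => /eqP -> /eqP /cI_inj[].
by target_of_par => ->; target_of_par => /cI_inj[].
Qed.

Lemma min_round_cW (R : realType) (M : memory R) ps n h p j :
  uniq ps -> p \in ps ->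
  run_step M (min_round ps n h) (cW p j) =
  if combines n h j && ~~ (cost_of (M (cW p j)) <= cost_of (M (cW p (j + 2 ^ h)%N)))%E
  then M (cW p (j + 2 ^ h)%N) else M (cW p j).
Proof.
move=> ups pps; case: (boolP (combines n h j)) => cj /=; last first.
  rewrite run_step_frame //; apply: contraNN cj => /mem_target_par[p' _].
  case/mem_target_par => j'; rewrite mem_reduce_index => cj'.
  by rewrite /= inE => /eqP/cW_inj[_ ->].
pose i := IfLe (cW p j) (cW p j) (cW p (j + 2 ^ h)%N) (cW p j) (cW p (j + 2 ^ h)%N).
rewrite -[cW p j in LHS]/(target i) run_step_target //=.
- by case: ifP.
- exact: min_round_exclusive.
apply/flatten_mapP; exists p => //; apply/flatten_mapP; exists j.
  by rewrite mem_reduce_index.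
by rewrite mem_seq1.
Qed.

Lemma index_round_cI (R : realType) (M : memory R) ps n h p j :
  uniq ps -> p \in ps ->
  run_step M (index_round ps n h) (cI p j) =
  if combines n h j && ~~ (cost_of (M (cW p j)) <= cost_of (M (cW p (j + 2 ^ h)%N)))%E
  then M (cI p (j + 2 ^ h)%N) else M (cI p j).
Proof.
move=> ups pps; case: (boolP (combines n h j)) => cj /=; last first.
  rewrite run_step_frame //; apply: contraNN cj => /mem_target_par[p' _].
  case/mem_target_par => j'; rewrite mem_reduce_index => cj'.
  by rewrite /= inE => /eqP/cI_inj[_ ->].
pose i := IfLe (cI p j) (cW p j) (cW p (j + 2 ^ h)%N) (cI p j) (cI p (j + 2 ^ h)%N).
rewrite -[cI p j in LHS]/(target i) run_step_target //=.
- by case: ifP.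
- exact: index_round_exclusive.
apply/flatten_mapP; exists p => //; apply/flatten_mapP; exists j.
  by rewrite mem_reduce_index.
by rewrite mem_seq1.
Qed.

Lemma min_round_writes ps n h : writes [:: 10%N] (min_round ps n h).
Proof. by writes_pars. Qed.

Lemma index_round_writes ps n h : writes [:: 11%N] (index_round ps n h).
Proof. by writes_pars. Qed.

Lemma min_reduce_writes ps n : all (writes [:: 10%N]) (min_reduce ps n).
Proof. by rewrite all_map; apply/allP => h _; exact: min_round_writes. Qed.

Lemma argmin_reduce_writes ps n :
  all (writes [:: 10; 11]%N) (argmin_reduce ps n).
Proof.
rewrite all_par; apply/allP => h _ /=; rewrite andbT; apply/andP.
by split; writes_pars.
Qed.

Lemma min_reduce_exclusive ps n :
  uniq ps -> all exclusive (min_reduce ps n).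
Proof.
by move=> ups; rewrite all_map; apply/allP => h _; exact: min_round_exclusive.
Qed.

Lemma argmin_reduce_exclusive ps n :
  uniq ps -> all exclusive (argmin_reduce ps n).
Proof.
move=> ups; rewrite all_par; apply/allP => h _ /=.
by rewrite index_round_exclusive // min_round_exclusive.
Qed.

Lemma iota_last m n : iota m n.+1 = iota m n ++ [:: (m + n)%N].
Proof. by rewrite -addn1 iotaD. Qed.

Lemma min_roundsP (R : realType) (M : memory R) ps n h p j :
  uniq ps -> p \in ps ->
  exec M [seq min_round ps n h' | h' <- iota 0 h] (cW p j) =
  M (cW p (champion n (fun i => cost_of (M (cW p i))) h j)).
Proof.
move=> ups pps; elim: h j => // h IH j.
rewrite iota_last map_cat exec_cat /= exec_cons [LHS]min_round_cW // !IH.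
by case: ifP.
Qed.

(** The index round comes first and leaves the values alone, so the value round repeats exactly the
    same comparisons. Hence both arrays follow the same champion, ties included. *)
Lemma argmin_roundsP (R : realType) (M : memory R) ps n h p j :
  uniq ps -> p \in ps ->
  let M' := exec M [par h' <- iota 0 h => [:: index_round ps n h'; min_round ps n h']] in
  let i := champion n (fun i => cost_of (M (cW p i))) h j in
  M' (cW p j) = M (cW p i) /\ M' (cI p j) = M (cI p i).
Proof.
move=> ups pps; elim: h j => [|h IH] j //.
rewrite iota_last map_cat flatten_cat exec_cat /= add0n.
set M' := exec M _ in IH *; rewrite !exec_cons.
have EW k : run_step M' (index_round ps n h) (cW p k) = M' (cW p k).
  by apply: run_step_frame; apply: writes_notin (index_round_writes _ _ _) _.
split.
  rewrite [LHS]min_round_cW // !EW (IH j).1 (IH (j + 2 ^ h)%N).1.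
  by case: ifP.
rewrite [LHS]run_step_frame; last first.
  by apply: writes_notin (min_round_writes _ _ _) _.
rewrite index_round_cI // (IH j).1 (IH (j + 2 ^ h)%N).1.
by rewrite (IH j).2 (IH (j + 2 ^ h)%N).2; case: ifP.
Qed.

(** For [n = 0] the cell would keep its old contents while the empty minimum is [+oo], hence the
    positivity assumption. *)
Lemma min_reduceP (R : realType) (M : memory R) ps n p (w : 'I_n -> \bar R) :
  uniq ps -> p \in ps -> (0 < n)%N ->
  (forall j : 'I_n, M (cW p j) = Cost (w j)) ->
  exec M (min_reduce ps n) (cW p 0) = Cost (\big[Order.min/+oo%E]_(j < n) w j).
Proof.
move=> ups pps n0 Mw; rewrite min_roundsP //.
have [/= cn cmin] := champion_argmin (fun i => cost_of (M (cW p i))) n0.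
rewrite (Mw (Ordinal cn)); congr Cost; apply/eqP; rewrite eq_le; apply/andP; split.
  apply: le_bigmin => [|j _]; first exact: leey.
  by have := cmin j (ltn_ord j); rewrite (Mw (Ordinal cn)) Mw.
exact: (bigmin_le (+oo%E) (Ordinal cn) w).
Qed.

Lemma argmin_reduceP (R : realType) (M : memory R) ps n p (w : 'I_n -> \bar R) :
  uniq ps -> p \in ps -> (0 < n)%N ->
  (forall j : 'I_n, M (cW p j) = Cost (w j)) ->
  (forall j : 'I_n, M (cI p j) = Idx j) ->
  exists2 i : 'I_n, exec M (argmin_reduce ps n) (cI p 0) = Idx i & minimises w i.
Proof.
move=> ups pps n0 Mw Mi.
have [/= cn cmin] := champion_argmin (fun i => cost_of (M (cW p i))) n0.
exists (Ordinal cn) => [|j].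
  have /= [_ ->] := @argmin_roundsP R M ps n (up_log 2 n) p 0 ups pps.
  exact: (Mi (Ordinal cn)).
by have := cmin j (ltn_ord j); rewrite (Mw (Ordinal cn)) Mw.
Qed.

(** * Parallel scan *)

Definition scan_round (n : nat) (rs : seq (nat * nat)) : bool :=
  [&& uniq (map snd rs), all (fun r => (r.1 < r.2 < n)%N) rs
    & all (fun r => r.1 \notin map snd rs) rs].

(** * Powers of 2 and the positions touched by the sweeps *)

Lemma dvdn_exp2S d x : (2 ^ d.+1 %| x -> 2 ^ d %| x)%N.
Proof. by apply: dvdn_trans; rewrite expnS dvdn_mull. Qed.

Lemma exp2_Ndvdn d : (2 ^ d.+1 %| 2 ^ d)%N = false.
Proof. by rewrite gtnNdvd ?expn_gt0 // ltn_exp2l. Qed.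

(** For the down-sweep, with [x = j.+1]: the block at [j] has length [2 ^ d], and the position just
    before it is divisible by a higher power of 2, so it is already finished. *)
Lemma exp2_sub_odd_multiple d x :
  (2 ^ d %| x)%N -> ~~ (2 ^ d.+1 %| x)%N ->
  (2 ^ d <= x)%N /\ (2 ^ d.+1 %| x - 2 ^ d)%N.
Proof.
case/dvdnP => q ->; rewrite expnS dvdn_pmul2r ?expn_gt0 // => q2.
have q1 : (0 < q)%N by case: q q2.
rewrite -[X in (_ * _ - X)%N]mul1n -mulnBl dvdn_pmul2r ?expn_gt0 //.
by split; [rewrite leq_pmull | lia].
Qed.

(** For the up-sweep, with [x = j.+1]: the left operand of the update of [j] is not itself updated
    in that round, and its block has length exactly [2 ^ d]. *)
Lemma exp2_sub_even_multiple d x :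
  (2 ^ d.+1 %| x)%N -> (0 < x)%N ->
  [/\ (2 ^ d < x)%N, (2 ^ d %| x - 2 ^ d)%N & ~~ (2 ^ d.+1 %| x - 2 ^ d)%N].
Proof.
move=> dx x0; have lt_x : (2 ^ d < x)%N.
  by apply: leq_trans (dvdn_leq x0 dx); rewrite ltn_exp2l.
split=> //; first by rewrite dvdn_sub // dvdn_exp2S.
by rewrite dvdn_subr ?exp2_Ndvdn // ltnW.
Qed.

(* The length of the block of factors collected at position [x.-1] by the
   first [d] rounds of the up-sweep. *)
Fixpoint block_length (d x : nat) : nat :=
  if d is d'.+1 then
    if (2 ^ d %| x)%N then (2 ^ d)%N else block_length d' x
  else 1%N.

Lemma block_length_dvd d x : (2 ^ d %| x)%N -> block_length d x = (2 ^ d)%N.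
Proof. by case: d => //= d ->. Qed.

(** Once [e] reaches the exponent [d] of 2 in [x], the block no longer grows. *)
Lemma block_length_eq d e x : (d <= e)%N ->
  (2 ^ d %| x)%N -> ~~ (2 ^ d.+1 %| x)%N -> block_length e x = (2 ^ d)%N.
Proof.
move=> de dx ndx; elim: e de => [|e IH] de.
  by move: de dx; rewrite leqn0 => /eqP ->.
case: (ltngtP d e.+1) de => // [de _|<- _]; last exact: block_length_dvd.
have /negPf /= -> : ~~ (2 ^ e.+1 %| x)%N; last exact: IH.
by apply: contraNN ndx; apply: dvdn_trans; rewrite dvdn_exp2l.
Qed.

Lemma mem_up_round n d r :
  r \in up_round n d -> [/\ (r.2 < n)%N, (2 ^ d.+1 %| r.2.+1)%N & r.1 = (r.2 - 2 ^ d)%N].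
Proof. by case/mapP => j; rewrite mem_filter mem_iota => /and3P[? _ ?] ->. Qed.

Lemma mem_down_round n d r :
  r \in down_round n d ->
  [/\ (r.2 < n)%N, (2 ^ d.+1 %| r.1.+1)%N & r.2 = (r.1 + 2 ^ d)%N].
Proof. by case/mapP => j; rewrite mem_filter => /andP[/andP[? ?] _] ->. Qed.

Lemma up_roundP n d : scan_round n (up_round n d).
Proof.
apply/and3P; split.
- rewrite -map_comp map_inj_in_uniq ?filter_uniq ?iota_uniq // => ? ? _ _ //.
- apply/allP => r /mem_up_round[rn rd ->]; rewrite rn andbT.
  have [lt_r _ _] := exp2_sub_even_multiple rd isT.
  by rewrite ltn_subrL expn_gt0 (leq_trans _ (lt_r : 2 ^ d <= r.2)%N) // expn_gt0.
apply/allP => r /mem_up_round[rn rd ->]; apply/mapP => -[r' /mem_up_round[_ rd' _] rr'].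
have [lt_r _] := exp2_sub_even_multiple rd isT; rewrite -rr' in rd'.
by rewrite subSn ?rd'.
Qed.

Lemma down_roundP n d : scan_round n (down_round n d).
Proof.
apply/and3P; split.
- by rewrite -map_comp map_inj_in_uniq ?filter_uniq ?iota_uniq // => ? ? _ _ /= /addIn.
- apply/allP => r /mem_down_round[-> _ ->]; rewrite andbT.
  by rewrite -[X in (X < _)%N]addn0 ltn_add2l expn_gt0.
apply/allP => r /mem_down_round[_ rd _]; apply/mapP => -[r' /mem_down_round[_ rd' e] rr'].
by move: rd; rewrite rr' e -addSn dvdn_addr // exp2_Ndvdn.
Qed.

Lemma scan_roundsP n : all (scan_round n) (scan_rounds n).
Proof.
by rewrite all_cat !all_map; apply/andP; split; apply/allP => d _;
  rewrite /= (up_roundP, down_roundP).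
Qed.

(** [Q s i j] is meant as: in state [s], cell [j] holds the product of the factors [i] to [j]. With
    the state and the product abstract, one induction on the rounds serves the min-plus scans in
    both directions and the composition scan; the first hypothesis, which glues adjacent intervals,
    takes the place of associativity. *)
Lemma scan_products (St : Type) (step : St -> seq (nat * nat) -> St)
    (Q : St -> nat -> nat -> Prop) (n : nat) (s0 : St) :
  (forall s rs r i, scan_round n rs -> r \in rs -> (i <= r.1)%N ->
     Q s i r.1 -> Q s r.1.+1 r.2 -> Q (step s rs) i r.2) ->
  (forall s rs i j, scan_round n rs -> (j < n)%N -> j \notin map snd rs ->
     Q s i j -> Q (step s rs) i j) ->
  (forall j, (j < n)%N -> Q s0 j j) ->
  forall j, (j < n)%N -> Q (foldl step s0 (scan_rounds n)) 0 j.
Proof.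
move=> upd keep init; set L := up_log 2 n.
have up d j : (j < n)%N ->
    Q (foldl step s0 [seq up_round n e | e <- iota 0 d]) (j.+1 - block_length d j.+1)%N j.
  elim: d j => [|d IH] j jn; first by rewrite /= subn1; exact: init.
  rewrite iota_last map_cat foldl_cat /= add0n; case: ifP => dj; last first.
    apply: keep; [exact: up_roundP | done | | exact: IH].
    by apply/mapP => -[r /mem_up_round[_ dr _] rj]; rewrite rj dr in dj.
  have [lt_j dvd_i ndvd_i] := exp2_sub_even_multiple dj isT.
  have rin : (j - 2 ^ d, j)%N \in up_round n d.
    by apply/mapP; exists j; rewrite // mem_filter mem_iota dj.
  apply: (upd _ _ _ _ (up_roundP n d) rin) => /=.
  - by rewrite expnS; lia.
  - have := IH (j - 2 ^ d)%N (leq_ltn_trans (leq_subr _ _) jn).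
    rewrite -subSn; last by rewrite -ltnS.
    by rewrite block_length_dvd // -subnDA addnn -mul2n -expnS.
  - by have := IH j jn; rewrite (block_length_dvd (dvdn_exp2S dj)) subSn.
(* After the levels [L - 1] down to [d], the positions with [2 ^ d] dividing [j.+1] hold their full
   prefix; the others still hold what the up-sweep left. *)
have down d : (d <= L)%N -> forall j, (j < n)%N ->
    Q (foldl step (foldl step s0 [seq up_round n e | e <- iota 0 L])
         [seq down_round n e | e <- rev (iota d (L - d))])
      (if (2 ^ d %| j.+1)%N then 0%N else j.+1 - block_length L j.+1)%N j.
  (* The level decreases along the sweep, so the induction is on the number [m] of levels done. *)
  move=> dL; rewrite -(subKn dL); move: (L - d)%N (leq_subr d L) => m mL {dL d}.
  rewrite subKn //; elim: m mL => [|m IH] mL j jn.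
    rewrite subn0 /=; have := up L j jn; case: ifP => // dj.
    (* Since [j.+1 <= n <= 2 ^ L], divisibility by [2 ^ L] forces equality, and the up-sweep alone
       has completed this prefix. *)
    rewrite block_length_dvd //; suff -> : (2 ^ L = j.+1)%N by rewrite subnn.
    apply/eqP; rewrite eqn_leq dvdn_leq //=.
    by apply: leq_trans jn _; exact: up_logP.
  have {}IH := IH (ltnW mL).
  have eL : (L - m = (L - m.+1).+1)%N by lia.
  move: (L - m.+1)%N (leq_subr m.+1 L) eL => d dL eL; rewrite eL in IH.
  rewrite /= rev_cons map_rcons -cats1 foldl_cat /=.
  set s := foldl _ _ _ in IH *.
  have keepd i : j \notin map snd (down_round n d) -> Q s i j ->
      Q (step s (down_round n d)) i j.
    by apply: keep => //; exact: down_roundP.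
  have target_dvd : j \in map snd (down_round n d) ->
      [/\ (2 ^ d %| j.+1)%N, ~~ (2 ^ d.+1 %| j.+1)%N & (2 ^ d <= j)%N].
    case/mapP => r /mem_down_round[_ dr e] ->; rewrite e leq_addl -addSn.
    by rewrite (dvdn_addr _ (dvdn_exp2S dr)) (dvdn_addr _ dr) dvdnn exp2_Ndvdn.
  have dL' : (d < L)%N by lia.
  case: ifP => dj; last first.
    apply: keepd; first by apply/negP => /target_dvd[]; rewrite dj.
    have := IH j jn; case: ifP => // dj'; first by rewrite dvdn_exp2S in dj.
  case: (boolP (2 ^ d.+1 %| j.+1)%N) => dj'.
    apply: keepd; first by apply/negP => /target_dvd[_]; rewrite dj'.
    by have := IH j jn; rewrite dj'.
  have [le_j dvd_i] := exp2_sub_odd_multiple dj dj'.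
  have := IH j jn; rewrite (negPf dj') (block_length_eq (ltnW dL') dj dj').
  (* If [j.+1 = 2 ^ d], the block already starts at [0]; there is nothing to prepend and [j] is not
     a destination. *)
  case: (ltngtP (2 ^ d)%N j.+1) le_j => // [lt_j _|e _]; last first.
    rewrite e subnn; apply: keepd.
    by apply/negP => /target_dvd[_ _]; rewrite e ltnn.
  rewrite ltnS in lt_j; rewrite subSn // in dvd_i *.
  have rin : (j - 2 ^ d, j)%N \in down_round n d.
    apply/mapP; exists (j - 2 ^ d)%N; last by rewrite subnK.
    by rewrite mem_filter mem_iota dvd_i subnK // jn /=; lia.
  move=> Qj; apply: (upd _ _ _ _ (down_roundP n d) rin) => //=.
  by have := IH (j - 2 ^ d)%N (leq_ltn_trans (leq_subr _ _) jn); rewrite dvd_i.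
move=> j jn; have := down 0%N (leq0n _) j jn.
by rewrite dvd1n subn0 foldl_cat.
Qed.

(** * Bellman operators *)

Section Bellman.
Context (R : realType) (Dx Du : nat) (cp : control_problem R Dx Du).

(** With a free final cost [G], the same recursion gives the value functions (terminal cost) and the
    conditional ones ([delta y]), so both splittings come from the same two lemmas. *)
Fixpoint bellman (n k : nat) (G : 'I_Dx -> \bar R) (x : 'I_Dx) : \bar R :=
  if n is n'.+1 then
    \big[Order.min/+oo%E]_(u < Du)
      ((stage cp k x u)%:E + bellman n' k.+1 G (dyn cp k x u))%E
  else G x.

(* The unit of the min-plus matrix product. *)
Definition delta (y x : 'I_Dx) : \bar R := if x == y then 0%E else +oo%E.

Lemma delta_gtNy y x : (-oo < delta y x)%E.
Proof. by rewrite /delta; case: ifP; rewrite ?ltNyr. Qed.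

Lemma value_bellman T k x :
  value cp T k x = bellman (T - k) k (fun z => (terminal cp z)%:E) x.
Proof.
rewrite /value; move: (T - k)%N => n; elim: n k x => //= n IH k x.
by apply: eq_bigr => u _; rewrite IH.
Qed.

Lemma bellman_gtNy n k G x : (forall z, -oo < G z)%E -> (-oo < bellman n k G x)%E.
Proof.
move=> GN; elim: n k x => //= n IH k x.
apply/bigmin_gtP; split=> // u _.
by rewrite ltNye adde_eq_ninfty /= -ltNye IH.
Qed.

Lemma bellmanD m n k G x :
  bellman (m + n) k G x = bellman m k (bellman n (k + m) G) x.
Proof.
elim: m k x => [|m IH] k x /=; first by rewrite addn0.
by apply: eq_bigr => u _; rewrite IH addSnnS.
Qed.

(** For [c = -oo] and [n = 0] the two sides would be [-oo] and [+oo]. *)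
Lemma min_adder (c : \bar R) n (F : 'I_n -> \bar R) : (-oo < c)%E ->
  (\big[Order.min/+oo]_(i < n) F i + c = \big[Order.min/+oo]_(i < n) (F i + c))%E.
Proof.
move=> cN; apply: (big_morph (fun e => e + c)%E); last by rewrite addye // gt_eqF.
by move=> a b; case: (leP a b) => ab; [rewrite min_l | rewrite min_r] => //;
  rewrite leeD2r // ltW.
Qed.

Lemma min_addel (c : R) n (F : 'I_n -> \bar R) :
  (c%:E + \big[Order.min/+oo]_(i < n) F i = \big[Order.min/+oo]_(i < n) (c%:E + F i))%E.
Proof.
by rewrite addeC min_adder ?ltNyr //; apply: eq_bigr => i _; rewrite addeC.
Qed.

(** A Bellman operator is linear over the min-plus semiring, hence given by its matrix on the
    functions [delta z]: [H] is the minimum over [z] of [delta z + H z], and each step commutes with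
    minima and with added constants. Together with [bellmanD] this yields the matrix product. *)
Lemma bellman_kernel n k H x : (forall z, -oo < H z)%E ->
  bellman n k H x = \big[Order.min/+oo%E]_(z < Dx) (bellman n k (delta z) x + H z)%E.
Proof.
move=> HN; elim: n k x => [|n IH] k x /=.
  rewrite (bigminD1 x) //= {1}/delta eqxx add0e min_l //.
  apply: le_bigmin => [|z /negPf zx]; first exact: leey.
  by rewrite /delta eq_sym zx addye ?leey // gt_eqF.
under eq_bigr => u _ do rewrite IH min_addel.
rewrite exchange_big /=; apply: eq_bigr => z _; rewrite min_adder //.
by apply: eq_bigr => u _; rewrite addeA.
Qed.

(** Comparing lower bounds avoids exhibiting an optimal control sequence and decomposing tuples. The
    bound [c] varies in the induction: the stage cost is finite, so it can be subtracted from it. *)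
Lemma le_bellman_delta c n k x y :
  (c <= bellman n k (delta y) x)%E <->
  forall us : seq 'I_Du, size us = n -> steer cp k x us == y ->
    (c <= (steer_cost cp k x us)%:E)%E.
Proof.
elim: n c k x => [|n IH] c k x /=.
  rewrite /delta; split; first by move=> + [] //= _ xy; rewrite xy.
  by case: eqP => [-> h|_ _]; [exact: (h [::]) | rewrite leey].
split.
  move=> /bigmin_geP[_ le_c] [//|u us] [sz] /= st.
  have := le_c u isT; rewrite addeC -leeBlDr // => /IH/(_ us sz st).
  by rewrite leeBlDr // addeC.
move=> le_c; apply/bigmin_geP; split=> [|u _]; first exact: leey.
rewrite addeC -leeBlDr //; apply/IH => us sz st.
by rewrite leeBlDr // addeC; apply: (le_c (u :: us)) => //=; rewrite sz.
Qed.

Lemma cond_value_bellman k i x y :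
  cond_value cp k i x y = bellman (i - k) k (delta y) x.
Proof.
apply/eqP; rewrite eq_le; apply/andP; split.
  apply/le_bellman_delta => us sz st.
  have sz' : size us == (i - k)%N by apply/eqP.
  exact: (bigmin_le_cond _ (j := Tuple sz')).
apply/bigmin_geP; split=> [|us st]; first exact: leey.
by have /le_bellman_delta := lexx (bellman (i - k) k (delta y) x); apply; rewrite ?size_tuple.
Qed.

Lemma value_gtNy T k x : (-oo < value cp T k x)%E.
Proof. by rewrite value_bellman; apply: bellman_gtNy => z; rewrite ltNyr. Qed.

Lemma cond_value_split k j i x y : (k <= j <= i)%N ->
  cond_value cp k i x y =
  \big[Order.min/+oo%E]_(z < Dx) (cond_value cp k j x z + cond_value cp j i z y)%E.
Proof.
case/andP=> kj ji; rewrite cond_value_bellman.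
have -> : (i - k = (j - k) + (i - j))%N by lia.
rewrite bellmanD subnKC // bellman_kernel => [|z]; last first.
  by apply: bellman_gtNy => z'; exact: delta_gtNy.
by apply: eq_bigr => z _; rewrite !cond_value_bellman.
Qed.

Lemma value_split T k j x : (k <= j <= T)%N ->
  value cp T k x =
  \big[Order.min/+oo%E]_(z < Dx) (cond_value cp k j x z + value cp T j z)%E.
Proof.
case/andP=> kj jT; rewrite value_bellman.
have -> : (T - k = (j - k) + (T - j))%N by lia.
rewrite bellmanD subnKC // bellman_kernel => [|z]; last first.
  by apply: bellman_gtNy => z'; rewrite ltNyr.
by apply: eq_bigr => z _; rewrite cond_value_bellman value_bellman.
Qed.

(** The right-hand side is what the [IfEq] instructions and the reduction over controls compute. *)
Lemma cond_value_step k x y :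
  cond_value cp k k.+1 x y =
  \big[Order.min/+oo%E]_(u < Du)
    (if dyn cp k x u == y then (stage cp k x u)%:E else +oo)%E.
Proof.
rewrite cond_value_bellman subSnn /=; apply: eq_bigr => u _.
by rewrite /delta; case: ifP; rewrite ?adde0 ?addey.
Qed.

Lemma cond_value_refl k x y : cond_value cp k k x y = delta y x.
Proof. by rewrite cond_value_bellman subnn. Qed.

End Bellman.

(** * Programs *)

Lemma mem_par (I T : eqType) (s : seq I) (e : I -> seq T) i a :
  i \in s -> a \in e i -> a \in [par j <- s => e j].
Proof. by move=> si ai; apply/flatten_mapP; exists i. Qed.

Lemma iotaP n i : (i < n)%N -> i \in iota 0 n.
Proof. by rewrite mem_iota. Qed.

Definition cells3 (I : Type) (f : I -> nat) (s : seq I) (n : nat) : seq (seq nat) :=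
  [par i <- s => [par x <- iota 0 n => [par y <- iota 0 n => [:: [:: f i; x; y]]]]].

Lemma cells3_uniq (I : eqType) (f : I -> nat) s n :
  uniq (map f s) -> uniq (cells3 f s n).
Proof.
move=> us; apply: (uniq_par us) => [i _|i j a]; last first.
  case/flatten_mapP=> x _ /flatten_mapP[y _]; rewrite inE => /eqP ->.
  by case/flatten_mapP=> x' _ /flatten_mapP[y' _]; rewrite inE => /eqP[].
apply: (uniq_par (f := id)) => [|x _|x x' a]; first by rewrite map_id iota_uniq.
  apply: (uniq_par (f := id)) => // [|y y' a]; first by rewrite map_id iota_uniq.
  by rewrite !inE => /eqP -> /eqP[].
case/flatten_mapP=> y _; rewrite inE => /eqP ->.
by case/flatten_mapP=> y' _; rewrite inE => /eqP[].
Qed.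

Lemma mem_cells3 (I : eqType) (f : I -> nat) s n i x y :
  i \in s -> (x < n)%N -> (y < n)%N -> [:: f i; x; y] \in cells3 f s n.
Proof.
move=> si xn yn; apply: (mem_par si); apply: (mem_par (iotaP xn)).
by apply: (mem_par (iotaP yn)); exact: mem_head.
Qed.

(** [behead] drops the tag of the array, and [take 3] the position inside a reduction that may
    follow the three loop indices. *)
Lemma exclusive_keyed_pars (I : eqType) (f : I -> nat) s n (e : I -> nat -> nat -> pstep) :
  uniq (map f s) ->
  (forall i x y, exclusive (e i x y)) ->
  (forall i x y a, a \in map target (e i x y) -> take 3 (behead a) = [:: f i; x; y]) ->
  exclusive [par i <- s => [par x <- iota 0 n => [par y <- iota 0 n => e i x y]]].
Proof.
move=> us ue te; apply: (exclusive_par_key us) => [i _|i j a]; last first.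
  case/mem_target_par=> x _ /mem_target_par[y _ /te ta].
  by case/mem_target_par=> x' _ /mem_target_par[y' _ /te]; rewrite ta => -[].
apply: exclusive_par => [|x _|x x' a]; first exact: iota_uniq; last first.
  by case/mem_target_par=> y _ /te ta /mem_target_par[y' _ /te]; rewrite ta => -[].
apply: exclusive_par => // [|y y' a]; first exact: iota_uniq.
by move=> /te ta /te; rewrite ta => -[].
Qed.

Lemma mem_pars3 (I : eqType) s n (e : I -> nat -> nat -> pstep) i x y c :
  i \in s -> (x < n)%N -> (y < n)%N -> c \in e i x y ->
  c \in [par i <- s => [par x <- iota 0 n => [par y <- iota 0 n => e i x y]]].
Proof.
move=> si xn yn ce; apply: (mem_par si); apply: (mem_par (iotaP xn)).
exact: (mem_par (iotaP yn)).
Qed.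

Lemma exclusive_cW_par p n (e : nat -> instr) :
  (forall j, target (e j) = cW p j) -> exclusive [par j <- iota 0 n => [:: e j]].
Proof.
move=> te; apply: exclusive_par => //; first exact: iota_uniq.
by move=> j j' a; rewrite /= !inE !te => /eqP -> /eqP /cW_inj[].
Qed.

(** * Min-plus rounds and scans of tables *)

Lemma minplus_round_exclusive Dx ts :
  uniq (map fst ts) -> all exclusive (minplus_round Dx ts).
Proof.
move=> us; rewrite /= all_cat min_reduce_exclusive ?cells3_uniq //= andbT.
apply/andP; split; apply: (exclusive_keyed_pars _ us) => //.
- by move=> t x y; apply: (exclusive_cW_par (p := [:: t.1; x; y])).
- by move=> t x y a; case/mem_target_par=> z _; rewrite /= inE => /eqP ->.
- by move=> t x y a; rewrite /= inE => /eqP ->.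
Qed.

Lemma minplus_round_writes Dx ts : all (writes [:: 7; 10]%N) (minplus_round Dx ts).
Proof.
rewrite /= all_cat /= andbT; apply/and3P; split; try by writes_pars.
apply: sub_all (min_reduce_writes _ _) => s; apply: sub_all => i.
by rewrite !inE => ->; rewrite orbT.
Qed.

Lemma minplus_round_frame (R : realType) (M : memory R) Dx ts k x y :
  k \notin map fst ts -> exec M (minplus_round Dx ts) (cA k x y) = M (cA k x y).
Proof.
move=> kts; rewrite exec_cons exec_cat exec_cons [LHS]run_step_frame; last first.
  apply: contra kts => /mem_target_par[t tts] /mem_target_par[x' _].
  by case/mem_target_par=> y' _; rewrite /= inE => /eqP[-> _ _]; exact: map_f.
rewrite (exec_frame _ (min_reduce_writes _ _)) //.
apply: run_step_frame; apply: (writes_notin (tags := [:: 10%N])) => //.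
by writes_pars.
Qed.

(** Both operands are read in the initial memory [M], although one of them may be the destination:
    all sums are put in work cells before any table is overwritten. *)
Lemma minplus_roundP (R : realType) (M : memory R) Dx ts t x y :
  uniq (map fst ts) -> t \in ts -> (x < Dx)%N -> (y < Dx)%N ->
  exec M (minplus_round Dx ts) (cA t.1 x y) =
  Cost (\big[Order.min/+oo%E]_(z < Dx)
    (cost_of (M (cA t.2.1 x z)) + cost_of (M (cA t.2.2 z y)))%E).
Proof.
move=> us tts xD yD; have := minplus_round_exclusive Dx us.
rewrite /= all_cat /= andbT => /and3P[ex1 _ ex3].
rewrite exec_cons exec_cat exec_cons [LHS](run_step_at
  (i := Move (cA t.1 x y) (cW [:: t.1; x; y] 0)) _ ex3) //=; last first.
  by apply: (mem_pars3 tts xD yD); exact: mem_head.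
apply: (min_reduceP (w := fun z : 'I_Dx =>
  (cost_of (M (cA t.2.1 x z)) + cost_of (M (cA t.2.2 z y)))%E)).
- exact: (cells3_uniq _ us).
- exact: (mem_cells3 fst).
- exact: leq_ltn_trans xD.
move=> z; rewrite [LHS](run_step_at
  (i := Add (cW [:: t.1; x; y] z) (cA t.2.1 x z) (cA t.2.2 z y)) _ ex1) //.
apply: (mem_pars3 tts xD yD); apply: (mem_par (iotaP (ltn_ord z))); exact: mem_head.
Qed.

Lemma foldl_exec_flatten (R : realType) (A : Type) (M : memory R)
    (f : A -> program) (s : seq A) :
  exec M [par i <- s => f i] = foldl (fun M i => exec M (f i)) M s.
Proof. by elim: s M => //= i s IH M; rewrite exec_cat IH. Qed.

(* [swap] exchanges the operands, for a scan running backwards in time. *)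
Definition minplus_update (pos : nat -> nat) (swap : bool) (r : nat * nat) :
    nat * (nat * nat) :=
  (pos r.2, if swap then (pos r.2, pos r.1) else (pos r.1, pos r.2)).

(** The forward scan is convertible to the case [pos = addn S] without [swap], the backward one to
    [pos = subn T] with [swap] and [n = T.+1]. *)
Definition minplus_scan Dx pos swap n : program :=
  [par rs <- scan_rounds n => minplus_round Dx (map (minplus_update pos swap) rs)].

Lemma minplus_update_uniq pos swap n rs :
  {in [pred i | i < n]%N &, injective pos} -> scan_round n rs ->
  uniq (map fst (map (minplus_update pos swap) rs)).
Proof.
move=> inj /and3P[us /allP rn _].
have -> : map fst (map (minplus_update pos swap) rs) = map pos (map snd rs).
  by rewrite -!map_comp.
rewrite map_inj_in_uniq // => i j /mapP[r rs1 ->] /mapP[r' rs2 ->]; apply: inj.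
  by have /andP[] := rn _ rs1.
by have /andP[] := rn _ rs2.
Qed.

Lemma minplus_scan_exclusive Dx pos swap n :
  {in [pred i | i < n]%N &, injective pos} ->
  all exclusive (minplus_scan Dx pos swap n).
Proof.
move=> inj; rewrite all_par; apply/allP => rs /(allP (scan_roundsP n)) ok.
by apply: minplus_round_exclusive; exact: minplus_update_uniq ok.
Qed.

Lemma minplus_scan_writes Dx pos swap n :
  all (writes [:: 7; 10]%N) (minplus_scan Dx pos swap n).
Proof. by rewrite all_par; apply/allP => rs _; exact: minplus_round_writes. Qed.

(** [B i j] is the table for the positions [i] to [j]. Injectivity is asked below [n] only, because
    truncated subtraction sends all positions from [T] on to [0]. *)
Lemma minplus_scanP (R : realType) (M : memory R) Dx pos (swap : bool) n
    (B : nat -> nat -> 'I_Dx -> 'I_Dx -> \bar R) :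
  {in [pred i | i < n]%N &, injective pos} ->
  (forall i j k x y, (i <= j)%N -> (j < k < n)%N ->
     B i k x y = \big[Order.min/+oo%E]_(z < Dx)
       if swap then (B j.+1 k x z + B i j z y)%E else (B i j x z + B j.+1 k z y)%E) ->
  (forall j (x y : 'I_Dx), (j < n)%N -> M (cA (pos j) x y) = Cost (B j j x y)) ->
  forall j (x y : 'I_Dx), (j < n)%N ->
    exec M (minplus_scan Dx pos swap n) (cA (pos j) x y) = Cost (B 0%N j x y).
Proof.
move=> inj Bsplit init j x y jn; rewrite foldl_exec_flatten; move: j jn x y.
apply: (scan_products (Q := fun M i j => forall x y : 'I_Dx,
  M (cA (pos j) x y) = Cost (B i j x y))) => [{init}M rs r i ok rrs ir Q1 Q2 x y||].
- have us := minplus_update_uniq swap inj ok.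
  have r12 : (r.1 < r.2 < n)%N by case/and3P: ok => _ /allP/(_ _ rrs).
  rewrite [LHS](minplus_roundP M us (map_f _ rrs)) //= (Bsplit i r.1) //.
  by congr Cost; apply: eq_bigr => z _; case: (swap); rewrite /= Q1 Q2.
- move=> {init}M rs i j ok jn jrs Q x y; rewrite minplus_round_frame //.
  rewrite -map_comp; apply: contra jrs => /mapP[r rrs /= e].
  have r12 : (r.1 < r.2 < n)%N by case/and3P: ok => _ /allP/(_ _ rrs).
  by rewrite (inj _ _ _ _ e) ?map_f //; case/andP: r12.
- by move=> j jn x y; exact: init.
Qed.

(** * One-step conditional value functions *)

Lemma one_step_exclusive Dx Du ks : uniq ks -> all exclusive (one_step_program Dx Du ks).
Proof.
move=> us; have us' : uniq (map id ks) by rewrite map_id.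
rewrite /= all_cat /= (min_reduce_exclusive _ (cells3_uniq _ us')) /= andbT.
apply/andP; split; apply: (exclusive_keyed_pars _ us') => //.
- by move=> k x y; apply: (exclusive_cW_par (p := [:: k; x; y])).
- by move=> k x y a; case/mem_target_par=> z _; rewrite /= inE => /eqP ->.
- by move=> k x y a; rewrite /= inE => /eqP ->.
Qed.

Lemma one_step_writes Dx Du ks : all (writes [:: 7; 9; 10]%N) (one_step_program Dx Du ks).
Proof.
rewrite /= all_cat /= andbT; apply/and3P; split; try by writes_pars.
apply: sub_all (min_reduce_writes _ _) => s; apply: sub_all => i.
by rewrite !inE => ->; rewrite !orbT.
Qed.

Lemma one_step_programP (R : realType) (M : memory R) Dx Du
    (cp : control_problem R Dx Du) T ks k (x y : 'I_Dx) :
  (0 < Du)%N -> stores_problem cp T M -> uniq ks -> k \in ks -> (k < T)%N ->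
  exec M (one_step_program Dx Du ks) (cA k x y) = Cost (cond_value cp k k.+1 x y).
Proof.
move=> Du0 [storesFL _] us kks kT; have us' : uniq (map id ks) by rewrite map_id.
have := one_step_exclusive Dx Du us; rewrite /= all_cat /= andbT => /and3P[ex1 _ ex3].
rewrite exec_cons exec_cons exec_cat exec_cons [LHS](run_step_at
  (i := Move (cA k x y) (cW [:: k; (x : nat); (y : nat)] 0)) _ ex3) //=; last first.
  by apply: (mem_pars3 kks (ltn_ord x) (ltn_ord y)); exact: mem_head.
rewrite cond_value_step.
apply: min_reduceP => // [||u].
- exact: (cells3_uniq _ us').
- exact: (mem_cells3 id).
rewrite [LHS](run_step_at
  (i := IfEq (cW [:: k; (x : nat); (y : nat)] u) (cF k x u) y (cL k x u) cInf) _ ex1) //; last first.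
  apply: (mem_pars3 kks (ltn_ord x) (ltn_ord y)).
  by apply: (mem_par (iotaP (ltn_ord u))); exact: mem_head.
have [] := storesFL k x u kT.
by rewrite /run_step /= => -> ->; rewrite -val_eqE; case: ifP.
Qed.

Lemma exclusive_keyed_pars2 (I : eqType) (f : I -> nat) s n (e : I -> nat -> pstep) :
  uniq (map f s) ->
  (forall i x, exclusive (e i x)) ->
  (forall i x a, a \in map target (e i x) -> take 2 (behead a) = [:: f i; x]) ->
  exclusive [par i <- s => [par x <- iota 0 n => e i x]].
Proof.
move=> us ue te; apply: (exclusive_par_key us) => [i _|i j a]; last first.
  case/mem_target_par=> x _ /te ta.
  by case/mem_target_par=> x' _ /te; rewrite ta => -[].
apply: exclusive_par => // [|x x' a]; first exact: iota_uniq.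
by move=> /te ta /te; rewrite ta => -[].
Qed.

Definition cells2 (s : seq nat) (n : nat) : seq (seq nat) :=
  [par i <- s => [par x <- iota 0 n => [:: [:: i; x]]]].

Lemma cells2_uniq s n : uniq s -> uniq (cells2 s n).
Proof.
move=> us; apply: (uniq_par (f := id)) => [|i _|i j a]; first by rewrite map_id.
  apply: (uniq_par (f := id)) => // [|y y' a]; first by rewrite map_id iota_uniq.
  by rewrite !inE => /eqP -> /eqP[].
case/flatten_mapP=> x _; rewrite inE => /eqP ->.
by case/flatten_mapP=> x' _; rewrite inE => /eqP[].
Qed.

Lemma mem_pars2 (T : eqType) s n (e : nat -> nat -> seq T) i x c :
  i \in s -> (x < n)%N -> c \in e i x ->
  c \in [par i <- s => [par x <- iota 0 n => e i x]].
Proof. by move=> si xn ce; apply: (mem_par si); exact: (mem_par (iotaP xn)). Qed.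

Lemma exclusive_cI_par p n (e : nat -> instr) :
  (forall j, target (e j) = cI p j) -> exclusive [par j <- iota 0 n => [:: e j]].
Proof.
move=> te; apply: exclusive_par => //; first exact: iota_uniq.
by move=> j j' a; rewrite /= !inE !te => /eqP -> /eqP /cI_inj[].
Qed.

(** ** Value functions and control law *)

Lemma subn_inj_in T : {in [pred i | i < T.+1]%N &, injective (subn T)}.
Proof. by move=> i j; rewrite !inE => iT jT; lia. Qed.

Lemma value_program_exclusive Dx Du T : all exclusive (value_program Dx Du T).
Proof.
have scan := minplus_scan_exclusive Dx true (@subn_inj_in T).
rewrite all_cat one_step_exclusive ?iota_uniq // all_cat all_cat !all_seq1.
rewrite [all exclusive (backward_minplus_scan _ _)]scan.
apply/and4P; split=> //.
  apply: exclusive_par => [|x _|x x' a]; first exact: iota_uniq.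
    apply: exclusive_par => // [|y y' a]; first exact: iota_uniq.
    by rewrite /= !inE => /eqP -> /eqP[].
  case/mem_target_par=> y _; rewrite /= inE => /eqP ->.
  by case/mem_target_par=> y' _; rewrite /= inE => /eqP[].
apply: (exclusive_keyed_pars2 (f := id)) => //; first by rewrite map_id iota_uniq.
by move=> k x a; rewrite /= inE => /eqP ->.
Qed.

Lemma value_program_writes Dx Du T : all (writes [:: 3; 7; 9; 10]%N) (value_program Dx Du T).
Proof.
have sub tags p : all (writes tags) p -> {subset tags <= [:: 3; 7; 9; 10]%N} ->
    all (writes [:: 3; 7; 9; 10]%N) p.
  by move=> wp st; apply: sub_all wp => s; apply: sub_all => i; exact: st.
rewrite all_cat (sub _ _ (one_step_writes _ _ _)) => [|t]; last first.
  by rewrite !inE => /or3P[] ->; rewrite ?orbT.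
rewrite all_cat all_cat !all_seq1
  (sub _ _ (minplus_scan_writes _ (subn T) true _)) => [|t]; last first.
  by rewrite !inE => /orP[] ->; rewrite ?orbT.
by apply/and4P; split => //; writes_pars.
Qed.

Lemma value_programP (R : realType) (M : memory R) Dx Du
    (cp : control_problem R Dx Du) T :
  (0 < Du)%N -> stores_problem cp T M ->
  stores_values cp T (exec M (value_program Dx Du T)).
Proof.
move=> Du0 problem k x kT; have := value_program_exclusive Dx Du T.
rewrite all_cat => /andP[_]; rewrite all_cat all_seq1 => /andP[ex1].
rewrite all_cat all_seq1 => /andP[_ ex2].
rewrite exec_cat; set M1 := exec M _; rewrite exec_cat; set M2 := exec M1 _.
rewrite exec_cat exec_cons.
have Dx0 : (0 < Dx)%N by apply: leq_ltn_trans (ltn_ord x).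
rewrite [LHS](run_step_at (i := Move (cV k x) (cA k x 0)) _ ex2) //; last first.
  by apply: (mem_pars2 (iotaP (kT : (k < T.+1)%N)) (ltn_ord x)); exact: mem_head.
(* The positions [i] to [j] are the times [T - j] to [T - i], and the table of time [T - i] leads to
   [(T - i).+1]. An interval starting at position [0] contains the terminal element, whence a value
   function that ignores [y]. *)
pose B i j (x y : 'I_Dx) := if i == 0%N then value cp T (T - j) x
  else cond_value cp (T - j) (T - i).+1 x y.
rewrite -(subKn kT); have jT : (T - k < T.+1)%N by rewrite ltnS leq_subr.
(* The suffix products are constant in their second argument; [Ordinal Dx0] is the column [0] that
   the program copies. *)
apply: (minplus_scanP (M := M2) (pos := subn T) (swap := true) (B := B) _ _ _ x (Ordinal Dx0) jT).
- exact: subn_inj_in.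
- move=> i j l y z ij /andP[jl lT]; rewrite /B /= subnSK; last by lia.
  case: (i == 0%N) => /=; first by rewrite (@value_split _ _ _ _ _ _ (T - j)) //; lia.
  by rewrite (@cond_value_split _ _ _ _ _ (T - j)) //; lia.
move=> j y z jT'; rewrite /B; case: (posnP j) => [->|j0].
  rewrite subn0 /value subnn [LHS](run_step_at (i := Move (cA T y z) (cLT y)) _ ex1) //=.
    by rewrite /M1 (exec_frame _ (one_step_writes _ _ _)) //; exact: problem.2.
  by apply: (mem_pars2 _ (ltn_ord z)); [exact: iotaP | exact: mem_head].
rewrite [LHS]run_step_frame; last first.
  apply/negP => /mem_target_par[y' _] /mem_target_par[z' _].
  by rewrite /= inE => /eqP[]; lia.
apply: (one_step_programP _ _ Du0 problem); rewrite ?iota_uniq ?mem_iota //; lia.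
Qed.

Lemma law_program_exclusive Dx Du T : all exclusive (law_program Dx Du T).
Proof.
have ui : uniq (map id (iota 0 T)) by rewrite map_id iota_uniq.
rewrite all_cat all_cat /= argmin_reduce_exclusive ?cells2_uniq ?iota_uniq //=.
rewrite !andbT; apply/andP; split; [apply/and3P; split|];
  apply: (exclusive_keyed_pars2 _ ui) => //.
- by move=> k x; apply: (exclusive_cW_par (p := [:: k; x])).
- by move=> k x a; case/mem_target_par=> z _; rewrite /= inE => /eqP ->.
- by move=> k x; apply: (exclusive_cW_par (p := [:: k; x])).
- by move=> k x a; case/mem_target_par=> z _; rewrite /= inE => /eqP ->.
- by move=> k x; apply: (exclusive_cI_par (p := [:: k; x])).
- by move=> k x a; case/mem_target_par=> z _; rewrite /= inE => /eqP ->.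
- by move=> k x a; rewrite /= inE => /eqP ->.
Qed.

Lemma law_program_writes Dx Du T : all (writes [:: 4; 10; 11]%N) (law_program Dx Du T).
Proof.
rewrite all_cat all_cat /= !andbT; apply/and3P; split; last by writes_pars.
  by apply/and3P; split; writes_pars.
apply: sub_all (argmin_reduce_writes _ _) => s; apply: sub_all => i.
by rewrite !inE => /orP[] ->; rewrite !orbT.
Qed.

Lemma law_programP (R : realType) (M : memory R) Dx Du
    (cp : control_problem R Dx Du) T k (x : 'I_Dx) :
  (0 < Du)%N -> stores_problem cp T M -> stores_values cp T M -> (k < T)%N ->
  exists2 u : 'I_Du, exec M (law_program Dx Du T) (cU k x) = Idx u &
    minimises (q_value cp T k x) u.
Proof.
move=> Du0 [problem _] values kT; have := law_program_exclusive Dx Du T.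
rewrite all_cat all_cat /= !andbT => /and3P[/and3P[ex1 ex2 ex3] _ ex4].
have kin : k \in iota 0 T by exact: iotaP.
rewrite exec_cat !exec_cons; set M3 := exec _ [::]; rewrite exec_cat exec_cons.
have [|||u Mu mu] := @argmin_reduceP R M3 (cells2 (iota 0 T) Dx) Du [:: k; (x : nat)]
    (q_value cp T k x) (cells2_uniq _ (iota_uniq _ _)) _ Du0 _ _.
- by apply: (mem_pars2 kin (ltn_ord x)); exact: mem_head.
- move=> u; rewrite [LHS]run_step_frame; last first.
    by apply: (writes_notin (tags := [:: 11%N])) => //; writes_pars.
  rewrite
    (run_step_at (i := Add (cW [:: k; (x : nat)] u) (cL k x u) (cW [:: k; (x : nat)] u)) _ ex2) //; last first.
    apply: (mem_pars2 kin (ltn_ord x)); apply: (mem_par (iotaP (ltn_ord u))).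
    exact: mem_head.
  rewrite /= run_step_frame; last first.
    by apply: (writes_notin (tags := [:: 10%N])) => //; writes_pars.
  rewrite
    (run_step_at (i := Fetch (cW [:: k; (x : nat)] u) [:: 3; k.+1]%N (cF k x u) [::]) _ ex1) //; last first.
    apply: (mem_pars2 kin (ltn_ord x)); apply: (mem_par (iotaP (ltn_ord u))).
    exact: mem_head.
  have [/= -> ->] := problem k x u kT.
  by rewrite [M _](values k.+1 (dyn cp k x u) kT).
- move=> u; rewrite [LHS](run_step_at (i := Const (cI [:: k; (x : nat)] u) u) _ ex3) //.
  apply: (mem_pars2 kin (ltn_ord x)); apply: (mem_par (iotaP (ltn_ord u))).
  exact: mem_head.
exists u => //; rewrite [LHS]
  (run_step_at (i := Move (cU k x) (cI [:: k; (x : nat)] 0)) _ ex4) //.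
by apply: (mem_pars2 kin (ltn_ord x)); exact: mem_head.
Qed.

(** ** Trajectory recovery *)

Lemma optimal_stateS (R : realType) Dx Du (cp : control_problem R Dx Du) mu k x n :
  optimal_state cp mu k x n.+1 =
  dyn cp (k + n)%N (optimal_state cp mu k x n) (mu (k + n)%N (optimal_state cp mu k x n)).
Proof. by []. Qed.

Lemma optimal_stateD (R : realType) Dx Du (cp : control_problem R Dx Du) mu k x m n :
  optimal_state cp mu k x (m + n)%N =
  optimal_state cp mu (k + m)%N (optimal_state cp mu k x m) n.
Proof. by elim: n => [|n IH]; [rewrite addn0 | rewrite addnS !optimal_stateS IH addnA]. Qed.

Lemma mem_iota_sub S T k : (S <= k)%N -> (k < T)%N -> k \in iota S (T - S).
Proof. by rewrite mem_iota => Sk kT; rewrite Sk subnKC // ltnW // (leq_ltn_trans Sk). Qed.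

(** The last step of both methods. The result for the scan position of time [k] is the state at
    [k.+1], so the state at [S] has to come from [cX0]. *)
Definition store_trajectory (S n : nat) (f : nat -> addr) : pstep :=
  Move (cX S) cX0 :: [par k <- iota S n => [:: Move (cX k.+1) (f k)]].

Lemma store_trajectory_exclusive S n f : exclusive (store_trajectory S n f).
Proof.
apply/andP; split.
  apply/negP => /mem_target_par[k]; rewrite mem_iota => /andP[Sk _].
  by rewrite /= inE => /eqP[]; lia.
apply: exclusive_par => // [|k k' a]; first exact: iota_uniq.
by rewrite /= !inE => /eqP -> /eqP[].
Qed.

Lemma store_trajectory0 (R : realType) (M : memory R) S n f :
  run_step M (store_trajectory S n f) (cX S) = M cX0.
Proof. by rewrite /run_step /= eqxx. Qed.

Lemma store_trajectoryS (R : realType) (M : memory R) S n f k :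
  (S <= k < S + n)%N -> run_step M (store_trajectory S n f) (cX k.+1) = M (f k).
Proof.
move=> kn; rewrite
  (run_step_at (i := Move (cX k.+1) (f k)) _ (store_trajectory_exclusive _ _ _)) //.
by rewrite inE; apply/orP; right; apply: (mem_par (i := k)); rewrite ?mem_iota ?mem_head.
Qed.

Lemma composition_round_exclusive Dx S n rs : scan_round n rs ->
  exclusive [par r <- rs => [par x <- iota 0 Dx =>
    [:: Fetch (cG (S + r.2)%N x) [:: 8; (S + r.2)%N]%N (cG (S + r.1)%N x) [::]]]].
Proof.
case/and3P => us _ _; apply: (exclusive_keyed_pars2 (f := fun r => (S + r.2)%N)) => //.
  by rewrite (map_comp (addn S)) map_inj_uniq //; exact: addnI.
by move=> r x a; rewrite /= inE => /eqP ->.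
Qed.

Lemma composition_scan_exclusive Dx S n :
  all exclusive (forward_composition_scan Dx S n).
Proof.
rewrite all_map; apply/allP => rs /(allP (scan_roundsP n)).
exact: composition_round_exclusive.
Qed.

Lemma composition_scan_writes Dx S n :
  all (writes [:: 8%N]) (forward_composition_scan Dx S n).
Proof. by rewrite all_map; apply/allP => rs _ /=; writes_pars. Qed.

Lemma composition_scanP (R : realType) (M : memory R) Dx S n
    (F : nat -> nat -> 'I_Dx -> 'I_Dx) :
  (forall i j k x, (i <= j)%N -> (j < k < n)%N -> F i k x = F j.+1 k (F i j x)) ->
  (forall j (x : 'I_Dx), (j < n)%N -> M (cG (S + j)%N x) = Idx (F j j x)) ->
  forall j (x : 'I_Dx), (j < n)%N ->
    exec M (forward_composition_scan Dx S n) (cG (S + j)%N x) = Idx (F 0%N j x).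
Proof.
move=> Fsplit init j x jn.
pose step M rs := run_step (R := R) M [par r <- rs => [par x <- iota 0 Dx =>
    [:: Fetch (cG (S + r.2)%N x) [:: 8; (S + r.2)%N]%N (cG (S + r.1)%N x) [::]]]].
have -> : exec M (forward_composition_scan Dx S n) = foldl step M (scan_rounds n).
  by rewrite /exec /forward_composition_scan;
  elim: (scan_rounds n) M {init} => //= rs rss IH M; rewrite IH.
move: j jn x.
apply: (scan_products (Q := fun M i j => forall x : 'I_Dx,
  M (cG (S + j)%N x) = Idx (F i j x))) => [{init}M rs r i ok rrs ir Q1 Q2 x||].
- have r12 : (r.1 < r.2 < n)%N by case/and3P: ok => _ /allP/(_ _ rrs).
  rewrite [LHS](run_step_at (i := Fetch (cG (S + r.2)%N x) [:: 8; (S + r.2)%N]%N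
    (cG (S + r.1)%N x) [::]) _ (composition_round_exclusive _ _ ok)) //=.
    by rewrite Q1 (Fsplit i r.1 r.2) //; exact: Q2.
  by apply: (mem_par rrs); apply: (mem_par (iotaP (ltn_ord x))); exact: mem_head.
- move=> {init}M rs i j ok jn jrs Q x; rewrite [LHS]run_step_frame //.
  apply: contra jrs => /mem_target_par[r rrs] /mem_target_par[x' _].
  by rewrite /= inE => /eqP[/addnI -> _]; exact: map_f.
- by move=> j jn x; exact: init.
Qed.

Lemma trajectory_program1_exclusive Dx T S : all exclusive (trajectory_program1 Dx T S).
Proof.
rewrite !all_cat composition_scan_exclusive /= store_trajectory_exclusive !andbT.
apply/andP; split.
  apply: (exclusive_keyed_pars2 (f := id)) => //; first by rewrite map_id iota_uniq.
  by move=> k x a; rewrite /= inE => /eqP ->.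
apply: exclusive_par => // [|x x' a]; first exact: iota_uniq.
by rewrite /= !inE => /eqP -> /eqP[].
Qed.

Lemma trajectory_program1P (R : realType) (M : memory R) Dx Du
    (cp : control_problem R Dx Du) mu (xS : 'I_Dx) T S :
  (S < T)%N -> stores_problem cp T M -> stores_law T mu M -> M cX0 = Idx xS ->
  stores_trajectory T S (fun k => optimal_state cp mu S xS (k - S))
    (exec M (trajectory_program1 Dx T S)).
Proof.
move=> ST [problem _] law init k /andP[Sk kT].
have := trajectory_program1_exclusive Dx T S.
rewrite all_cat => /andP[/and3P[ex1 ex2 _] _].
rewrite !exec_cat !exec_cons.
set M1 := run_step M _; set M2 := exec (run_step M1 _) [::].
have M1G l x : (S <= l < T)%N -> M1 (cG l (x : 'I_Dx)) = Idx (dyn cp l x (mu l x)).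
  case/andP=> Sl lT; rewrite [LHS](run_step_at
    (i := Fetch (cG l x) [:: 0; l; (x : nat)]%N (cU l x) [::]) _ ex1) //=.
    by rewrite law //; exact: (problem l x (mu l x) lT).1.
  by apply: (mem_pars2 (mem_iota_sub Sl lT) (ltn_ord x)); exact: mem_head.
have M1X : M1 cX0 = Idx xS.
  rewrite -init; apply: run_step_frame.
  by apply: (writes_notin (tags := [:: 8%N])) => //; writes_pars.
(* The flow from time [S + i] to [S + j.+1]. A product that starts at position [0] contains the
   constant first factor and so ignores [x]. *)
pose F i j x := if i == 0%N then optimal_state cp mu S xS j.+1
  else optimal_state cp mu (S + i)%N x (j.+1 - i)%N.
have M2G j (x : 'I_Dx) : (j < T - S)%N -> M2 (cG (S + j)%N x) = Idx (F j j x).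
  move=> jT; rewrite /F; case: (posnP j) => [->|j0].
    rewrite addn0 [LHS](run_step_at (i := Fetch (cG S x) [:: 8; S]%N cX0 [::]) _ ex2) //=.
      by rewrite M1X [M1 _]M1G ?leqnn // -[in LHS](addn0 S).
    by apply: (mem_par (iotaP (ltn_ord x))); exact: mem_head.
  rewrite subSnn [RHS](_ : _ = Idx (dyn cp (S + j + 0)%N x (mu (S + j + 0)%N x))) //.
  rewrite addn0 [LHS]run_step_frame; first by apply: M1G; rewrite leq_addr -ltn_subRL.
  apply/negP => /mem_target_par[x' _].
  by rewrite /= inE => /eqP[]; lia.
have M3G := @composition_scanP R M2 Dx S (T - S) F _ M2G.
have Dx0 : (0 < Dx)%N by apply: leq_ltn_trans (ltn_ord xS).
case: (ltngtP S k) Sk => // [Sk _|<- _]; last first.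
  rewrite subnn [LHS]store_trajectory0 (exec_frame _ (composition_scan_writes _ _ _)) //.
  rewrite -M1X; apply: run_step_frame.
  by apply: (writes_notin (tags := [:: 8%N])) => //; writes_pars.
case: k Sk kT => // k Sk kT; rewrite [LHS]store_trajectoryS; last by lia.
have {1}-> : k = (S + (k - S))%N by lia.
rewrite (M3G _ _ (Ordinal Dx0)) /F.
- by rewrite eqxx subSn.
- move=> i j l x ij /andP[jl lT]; rewrite [j.+1 == _]/=.
  case: eqP => [_|/eqP i0].
    have -> : l.+1 = (j.+1 + (l.+1 - j.+1))%N by lia.
    by rewrite optimal_stateD addKn.
  have -> : (l.+1 - i = (j.+1 - i) + (l.+1 - j.+1))%N by lia.
  by rewrite optimal_stateD -addnA subnKC // leqW.
- lia.
Qed.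

Lemma addn_inj_in S n : {in [pred i | i < n]%N &, injective (addn S)}.
Proof. by move=> i j _ _ /addnI. Qed.

Definition cells1 (S n : nat) : seq (seq nat) := [par k <- iota S n => [:: [:: k.+1]]].

Lemma cells1_uniq S n : uniq (cells1 S n).
Proof.
apply: (uniq_par (f := id)) => // [|k k' a]; first by rewrite map_id iota_uniq.
by rewrite !inE => /eqP -> /eqP[].
Qed.

Lemma exclusive_succ_pars S n m (e : nat -> nat -> instr) :
  (forall k x, take 2 (behead (target (e k x))) = [:: k.+1; x]) ->
  exclusive [par k <- iota S n => [par x <- iota 0 m => [:: e k x]]].
Proof.
move=> te; apply: (exclusive_keyed_pars2 (f := succn)) => // [|k x a].
  by rewrite map_inj_uniq ?iota_uniq //; exact: succn_inj.
by rewrite inE => /eqP ->.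
Qed.

Lemma trajectory_program2_exclusive Dx Du T S :
  all exclusive (trajectory_program2 Dx Du T S).
Proof.
have scan := minplus_scan_exclusive Dx false (@addn_inj_in S (T - S)).
rewrite all_cat one_step_exclusive ?iota_uniq // all_cat.
rewrite [all exclusive (forward_minplus_scan _ _ _)]scan all_cat all_cat.
rewrite argmin_reduce_exclusive ?cells1_uniq // all_seq1 store_trajectory_exclusive.
by rewrite /= !andbT; apply/and3P; split; apply: exclusive_succ_pars.
Qed.

Lemma trajectory_program2P (R : realType) (M : memory R) Dx Du
    (cp : control_problem R Dx Du) (xS : 'I_Dx) T S :
  (0 < Du)%N -> (S < T)%N ->
  stores_problem cp T M -> stores_values cp T M -> M cX0 = Idx xS ->
  let M' := exec M (trajectory_program2 Dx Du T S) in
  M' (cX S) = Idx xS /\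
  forall k, (S < k <= T)%N -> exists2 x : 'I_Dx, M' (cX k) = Idx x &
    minimises (fun x => cond_value cp S k xS x + value cp T k x)%E x.
Proof.
move=> Du0 ST problem values init M'.
have := trajectory_program2_exclusive Dx Du T S.
rewrite all_cat => /andP[_]; rewrite all_cat => /andP[_].
rewrite all_cat => /andP[/and4P[ex1 ex2 ex3 _] _].
rewrite /M' exec_cat; set M1 := exec M _; rewrite exec_cat; set M2 := exec M1 _.
rewrite exec_cat; set M3 := exec M2 _; rewrite exec_cat.
(* The table of time [S + j] covers the step to [(S + j).+1], hence the successor at the upper end
   only. *)
pose B i j x y := cond_value cp (S + i)%N (S + j).+1 x y.
have M2A j (x y : 'I_Dx) : (j < T - S)%N -> M2 (cA (S + j)%N x y) = Cost (B 0%N j x y).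
  move=> jT; apply: (minplus_scanP (M := M1) (pos := addn S) (swap := false) (B := B)) jT.
  - exact: addn_inj_in.
  - move=> i l n y' z' il /andP[ln nT]; rewrite /B /= addnS.
    by apply: cond_value_split; lia.
  - move=> l y' z' lT; apply: (one_step_programP _ _ Du0 problem); rewrite ?iota_uniq //.
      by apply: mem_iota_sub; lia.
    by lia.
have M2frame a : head 0%N a \notin [:: 7; 9; 10]%N -> M2 a = M a.
  move=> ha; rewrite -[RHS](exec_frame M (one_step_writes Dx Du (iota S (T - S))) ha).
  apply: (exec_frame _ (minplus_scan_writes _ (addn S) false _)).
  by apply: contra ha; rewrite !inE => /orP[] ->; rewrite ?orbT.
have M3X : M3 cX0 = Idx xS.
  rewrite -init -M2frame //; apply: (exec_frame _ (tags := [:: 10; 11]%N)) => //.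
  by apply/and4P; split=> //; writes_pars.
split.
  rewrite [LHS]store_trajectory0 -M3X.
  exact: (exec_frame _ (argmin_reduce_writes _ _)).
case=> // k /andP[Sk kT]; have kin := mem_iota_sub (Sk : (S <= k)%N) kT.
have [|x|x|x Mx minx] := @argmin_reduceP R M3 (cells1 S (T - S)) Dx [:: k.+1]
    (fun x => cond_value cp S k.+1 xS x + value cp T k.+1 x)%E (cells1_uniq _ _) _
    (leq_ltn_trans (leq0n _) (ltn_ord xS)).
- by apply: (mem_par kin); exact: mem_head.
- rewrite [LHS]run_step_frame; last first.
    by apply: (writes_notin (tags := [:: 11%N])) => //; writes_pars.
  rewrite
    (run_step_at (i := Add (cW [:: k.+1] x) (cW [:: k.+1] x) (cV k.+1 x)) _ ex2) //; last first.
    by apply: (mem_pars2 kin (ltn_ord x)); exact: mem_head.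
  rewrite /=
    (run_step_at (i := Fetch (cW [:: k.+1] x) [:: 7; k]%N cX0 [:: (x : nat)]) _ ex1) //; last first.
    by apply: (mem_pars2 kin (ltn_ord x)); exact: mem_head.
  rewrite /= (M2frame cX0) // init run_step_frame; last first.
    by apply: (writes_notin (tags := [:: 10%N])) => //; writes_pars.
  rewrite (M2frame (cV k.+1 x)) // values //; have eK : (S + (k - S) = k)%N by lia.
  have := @M2A (k - S)%N xS x; rewrite /B addn0 eK => -> //; lia.
- rewrite [LHS](run_step_at (i := Const (cI [:: k.+1] x) x) _ ex3) //.
  by apply: (mem_pars2 kin (ltn_ord x)); exact: mem_head.
exists x => //; rewrite [LHS]store_trajectoryS //.
by lia.
Qed.

(** * Span *)

Lemma size_par_const (I T : Type) (s : seq I) (e : I -> seq T) c :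
  (forall i, size (e i) = c) -> size [par i <- s => e i] = (size s * c)%N.
Proof. by move=> ec; elim: s => //= i s IH; rewrite size_cat ec IH. Qed.

Lemma size_scan_rounds n : size (scan_rounds n) = (up_log 2 n).*2.
Proof. by rewrite size_cat !size_map size_rev size_iota addnn. Qed.

Lemma size_minplus_round Dx ts : size (minplus_round Dx ts) = (up_log 2 Dx).+2.
Proof. by rewrite /= size_cat size_map size_iota addn1. Qed.

Lemma size_minplus_scan Dx pos swap n :
  size (minplus_scan Dx pos swap n) = ((up_log 2 n).*2 * (up_log 2 Dx).+2)%N.
Proof.
rewrite -size_scan_rounds; apply: size_par_const => rs; exact: size_minplus_round.
Qed.

Lemma size_one_step_program Dx Du ks : size (one_step_program Dx Du ks) = (up_log 2 Du).+3.
Proof. by rewrite /= size_cat size_map size_iota addn1. Qed.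

Lemma size_argmin_reduce ps n : size (argmin_reduce ps n) = (up_log 2 n).*2.
Proof. by rewrite (@size_par_const _ _ _ _ 2) ?size_iota ?muln2. Qed.

Lemma size_value_program Dx Du T :
  size (value_program Dx Du T) =
  (5 + up_log 2 Du + (up_log 2 T.+1).*2 * (up_log 2 Dx).+2)%N.
Proof.
rewrite size_cat size_one_step_program size_cat size_cat.
rewrite [size (backward_minplus_scan _ _)](size_minplus_scan _ (subn T) true).
by rewrite /=; lia.
Qed.

Lemma size_law_program Dx Du T : size (law_program Dx Du T) = (4 + (up_log 2 Du).*2)%N.
Proof. by rewrite size_cat size_cat size_argmin_reduce /=; lia. Qed.

Lemma size_value_and_law_program Dx Du T :
  size (value_and_law_program Dx Du T) =
  (9 + 3 * up_log 2 Du + (up_log 2 T.+1).*2 * (up_log 2 Dx).+2)%N.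
Proof. by rewrite size_cat size_value_program size_law_program; lia. Qed.

Lemma size_trajectory_program1 Dx T S :
  size (trajectory_program1 Dx T S) = (3 + (up_log 2 (T - S)).*2)%N.
Proof. by rewrite !size_cat /= size_map size_scan_rounds; lia. Qed.

Lemma size_trajectory_program2 Dx Du T S :
  size (trajectory_program2 Dx Du T S) =
  (7 + up_log 2 Du + (up_log 2 Dx).*2 + (up_log 2 (T - S)).*2 * (up_log 2 Dx).+2)%N.
Proof.
rewrite size_cat size_one_step_program size_cat.
rewrite [size (forward_minplus_scan _ _ _)](size_minplus_scan _ (addn S) false).
by rewrite size_cat size_cat size_argmin_reduce /=; lia.
Qed.

(** * Binary logarithms compared with [lg] *)

Lemma lg_ge1 (R : realType) n : 1 <= lg R n.
Proof. by rewrite le_max lexx. Qed.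

(** From [1 + x <= expR x] at [x = -1/2]: [expR (-1/2) >= 1/2], and inverting gives
    [expR (1/2) <= 2]. *)
Lemma ln2_ge_half (R : realType) : 2^-1 <= ln 2 :> R.
Proof.
rewrite -ler_expR lnK ?posrE // -[2^-1]opprK expRN.
have := expR_ge1Dx (- 2^-1 : R); have := expR_gt0 (- 2^-1 : R).
set e := expR _ => e0 he; rewrite -[2]invrK lef_pV2 ?posrE //; lra.
Qed.

(** For [1 < n], [2 ^ (up_log 2 n).-1 < n]; taking logarithms, [up_log 2 n <= 1 + 2 * lg R n], and
    the [1] is absorbed by [lg]. *)
Lemma up_log_le_lg (R : realType) n : (up_log 2 n)%:R <= 3 * lg R n.
Proof.
have lg1 := lg_ge1 R n; case: (ltnP 1 n) => [n1|]; last first.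
  rewrite -[(n <= 1)%N]orFb -(up_log_eq0 2) => /eqP ->; rewrite mulr0n; lra.
have l0 : (0 < up_log 2 n)%N by rewrite up_log_gt0.
have lt_n := up_log_gtn (isT : 1 < 2)%N n1.
have le_ln : (up_log 2 n).-1%:R * ln 2 <= lg R n.
  rewrite le_max; apply/orP; right; rewrite mulr_natl -lnXn //.
  by rewrite ler_ln ?posrE ?exprn_gt0 ?ltr0n ?(ltn_trans _ n1) // -natrX ler_nat ltnW.
have : (up_log 2 n).-1%:R * 2^-1 <= lg R n.
  by apply: le_trans le_ln; rewrite ler_wpM2l // ln2_ge_half.
rewrite -(prednK l0) /= -[in X in _ -> X]natr1; lra.
Qed.

(** The backward scan has [T.+1] elements; as [n.+1 <= 2 * n], this costs at most one more level. *)
Lemma up_logS_le_lg (R : realType) n : (0 < n)%N -> (up_log 2 n.+1)%:R <= 4 * lg R n.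
Proof.
move=> n0; have : (up_log 2 n.+1 <= (up_log 2 n).+1)%N.
  by rewrite -up_log2_double //; apply: leq_up_log; lia.
rewrite -(ler_nat R) -natr1; have := up_log_le_lg R n; have := lg_ge1 R n; lra.
Qed.

Lemma up_log_mono_le_lg (R : realType) m n : (m <= n)%N -> (up_log 2 m)%:R <= 3 * lg R n.
Proof.
by move=> mn; apply: le_trans (up_log_le_lg R n); rewrite ler_nat leq_up_log.
Qed.

(** Two sweeps of [a] rounds, each round taking [b.+2] steps: the factor 10 is 2 for the sweeps
    times 5 from [3 * y + 2 <= 5 * y]. *)
Lemma scan_span (R : realType) (a b : nat) (x y c : R) : 0 <= c -> 1 <= x -> 1 <= y ->
  a%:R <= c * x -> b%:R <= 3 * y -> (a.*2 * b.+2)%:R <= (10 * c) * (x * y).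
Proof.
move=> c0 x1 y1 ax by_; have a2 : (a.*2)%:R = a%:R * 2 :> R by rewrite -muln2 natrM.
have b2 : b.+2%:R = b%:R + 2 :> R by rewrite -addn2 natrD.
rewrite natrM a2 b2; have -> : 10 * c * (x * y) = (c * x * 2) * (5 * y) by ring.
by apply: ler_pM; rewrite ?addr_ge0 ?mulr_ge0 //; lra.
Qed.

Theorem lemma16 (R : realType) :
  (* (i) value functions and control law *)
  (exists C : R, 0 < C /\
    forall Dx Du T : nat, (0 < Dx)%N -> (0 < Du)%N -> (0 < T)%N ->
    exists P0 : nat, forall P : nat, (P0 <= P)%N ->
    forall (cp : control_problem R Dx Du) (M : memory R),
      stores_problem cp T M ->
      exists (M' : memory R) (t : nat) (mu : nat -> 'I_Dx -> 'I_Du),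
        pram_run P (value_and_law_program Dx Du T) M M' t /\
        stores_values cp T M' /\
        control_law cp T mu /\ stores_law T mu M' /\
        t%:R <= C * (lg R Du + lg R T * lg R Dx)) /\
  (* (ii) trajectory recovery, Method 1 *)
  (exists C : R, 0 < C /\
    forall Dx Du T S : nat, (0 < Dx)%N -> (0 < Du)%N -> (S < T)%N ->
    exists P0 : nat, forall P : nat, (P0 <= P)%N ->
    forall (cp : control_problem R Dx Du) (mu : nat -> 'I_Dx -> 'I_Du)
           (xS : 'I_Dx) (M : memory R),
      stores_problem cp T M -> control_law cp T mu -> stores_law T mu M ->
      M cX0 = Idx xS ->
      exists (M' : memory R) (t : nat),
        pram_run P (trajectory_program1 Dx T S) M M' t /\
        stores_trajectory T S (fun k => optimal_state cp mu S xS (k - S)) M' /\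
        t%:R <= C * lg R T) /\
  (* (ii) trajectory recovery, Method 2 *)
  (exists C : R, 0 < C /\
    forall Dx Du T S : nat, (0 < Dx)%N -> (0 < Du)%N -> (S < T)%N ->
    exists P0 : nat, forall P : nat, (P0 <= P)%N ->
    forall (cp : control_problem R Dx Du) (xS : 'I_Dx) (M : memory R),
      stores_problem cp T M -> stores_values cp T M -> M cX0 = Idx xS ->
      exists (M' : memory R) (t : nat) (xs : nat -> 'I_Dx),
        pram_run P (trajectory_program2 Dx Du T S) M M' t /\
        stores_trajectory T S xs M' /\
        (forall k : nat, (S <= k <= T)%N ->
           minimises (fun x => (cond_value cp S k xS x + value cp T k x)%E)
                     (xs k)) /\
        t%:R <= C * (lg R Du + lg R Dx + lg R T * lg R Dx)).
Proof.
split; [|split].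
(* The scan needs [10 * 4]; the remaining [9 + 3 * up_log 2 Du] steps are at most [18 * lg R Du]. *)
- exists 40; split=> // Dx Du T Dx0 Du0 T0.
  exists (\max_(s <- value_and_law_program Dx Du T) size s) => P leP cp M problem.
  set M' := exec M (value_and_law_program Dx Du T).
  set M1 := exec M (value_program Dx Du T).
  have M'E : M' = exec M1 (law_program Dx Du T) by exact: exec_cat.
  have values : stores_values cp T M1 by exact: value_programP.
  have problem1 : stores_problem cp T M1.
    by case: problem => problem terminal; split=> [k x u kT|x];
      rewrite /M1 !(exec_frame M (value_program_writes Dx Du T)) //; exact: problem.
  have law k x := law_programP x Du0 problem1 values (k := k).
  (* The law is read off the final memory, so that it breaks ties as the reduction did; the default
     serves cells that do not contain a control. *)
  pose mu k x : 'I_Du := insubd (Ordinal Du0) (index_of (M' (cU k x))).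
  have muE k x (u : 'I_Du) : M' (cU k x) = Idx u -> mu k x = u.
    by rewrite /mu => -> /=; exact: valKd.
  exists M', (size (value_and_law_program Dx Du T)), mu; split; last split; last split; last split.
  + apply: pram_run_exec leP _.
    by rewrite all_cat value_program_exclusive law_program_exclusive.
  + move=> k x kT; rewrite M'E (exec_frame _ (law_program_writes _ _ _)) //.
    exact: values.
  + by move=> k x kT; have [u + minu] := law k x kT; rewrite -M'E => /muE ->.
  + move=> k x kT; have [u + _] := law k x kT; rewrite -M'E => e.
    by rewrite e (muE _ _ _ e).
  rewrite size_value_and_law_program !natrD natrM.
  have := scan_span _ (lg_ge1 R T) (lg_ge1 R Dx) (up_logS_le_lg R T0) (up_log_le_lg R Dx).
  have := up_log_le_lg R Du; have := lg_ge1 R Du; lra.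
- exists 9; split=> // Dx Du T S Dx0 Du0 ST.
  exists (\max_(s <- trajectory_program1 Dx T S) size s) => P leP cp mu xS M problem _ law init.
  exists (exec M (trajectory_program1 Dx T S)), (size (trajectory_program1 Dx T S)).
  split; first by apply: pram_run_exec leP _; exact: trajectory_program1_exclusive.
  split; first exact: trajectory_program1P.
  rewrite size_trajectory_program1 natrD -muln2 natrM.
  have := up_log_mono_le_lg R (leq_subr S T); have := lg_ge1 R T; lra.
exists 40; split=> // Dx Du T S Dx0 Du0 ST.
exists (\max_(s <- trajectory_program2 Dx Du T S) size s) => P leP cp xS M problem values init.
set M' := exec M (trajectory_program2 Dx Du T S).
have [M'S M'k] := trajectory_program2P Du0 ST problem values init.
pose xs k : 'I_Dx := insubd xS (index_of (M' (cX k))).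
have xsE k (x : 'I_Dx) : M' (cX k) = Idx x -> xs k = x.
  by rewrite /xs => -> /=; exact: valKd.
exists M', (size (trajectory_program2 Dx Du T S)), xs; split; last split; last split.
- by apply: pram_run_exec leP _; exact: trajectory_program2_exclusive.
- move=> k /andP[Sk kT]; case: (ltngtP S k) Sk => // [Sk _|<- _].
    have [|x e _] := M'k k; first by rewrite Sk.
    by rewrite -/M' in e; rewrite e (xsE _ _ e).
  by rewrite (xsE _ _ M'S).
- move=> k /andP[Sk kT]; case: (ltngtP S k) Sk => // [Sk _|<- _].
    by have [|x /xsE -> //] := M'k k; rewrite Sk.
  (* At time [S] every state other than [xS] is at infinite cost; it stays infinite after adding a
     value function, which is above [-oo]. *)
  rewrite (xsE _ _ M'S) => y; rewrite !cond_value_refl /delta eqxx add0e.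
  case: eqP => [<-|_]; first by rewrite add0e.
  by rewrite addye ?leey // gt_eqF // value_gtNy.
rewrite size_trajectory_program2 !natrD -muln2 natrM.
have := scan_span _ (lg_ge1 R T) (lg_ge1 R Dx)
  (up_log_mono_le_lg R (leq_subr S T)) (up_log_le_lg R Dx).
have := up_log_le_lg R Du; have := lg_ge1 R Du.
have := up_log_le_lg R Dx; have := lg_ge1 R Dx.
(* The scan bound has constant [10 * 3]; to relax it to 40, [lra] needs the sign of this product,
   which it treats as an atom. *)
have : 0 <= lg R T * lg R Dx by rewrite mulr_ge0 // (le_trans ler01) // lg_ge1.
lra.
Qed.
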